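(* Let $G$ be a Lie group with Lie algebra $\mathfrak{g}$, and for $\xi\in\mathfrak{g}$ let $CM_\xi:=\{g\in G:\mathrm{Ad}_g\,\xi=\xi\}$. Then: (a) For every $\xi\in\mathfrak{g}$, $CM_\xi$ is a subgroup of $G$. (b) The Lie algebra of $CM_\xi$ is the kernel of $\mathrm{ad}_\xi=[\xi,\cdot\,]$, i.e. $\mathfrak{cm}_\xi=\{\eta\in\mathfrak{g}:[\xi,\eta]=0\}$.
   Context: $\mathrm{Ad}_g:\mathfrak{g}\to\mathfrak{g}$ is the adjoint representation of $G$, and $[\cdot,\cdot]$ is the Lie bracket on $\mathfrak{g}$. $\mathfrak{cm}_\xi$ denotes the Lie algebra (tangent space at the identity) of $CM_\xi$. *)

(* Defs.v *)
From HB Require Import structures.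
From mathcomp Require Import all_boot all_order all_algebra.
From mathcomp Require Import all_classical all_reals all_analysis.

Set Implicit Arguments.
Unset Strict Implicit.
Unset Printing Implicit Defensive.

Import Order.TTheory GRing.Theory Num.Theory.
Import numFieldNormedType.Exports.

Local Open Scope classical_set_scope.
Local Open Scope ring_scope.

(* To be used with U open.  Between finite-dimensional spaces, asking for the
   directional derivatives along all vectors is the same as asking for the
   partial derivatives. *)
Fixpoint Ck_on (R : realType) (V W : normedModType R) (k : nat)
    (U : set V) (f : V -> W) : Prop :=
  {in U, continuous f} /\
  match k with
  | 0%N => True
  | k'.+1 => forall v : V,
      {in U, forall x, derivable f x v} /\ Ck_on k' U (fun x => 'D_v f x)
  end.

Definition smooth_on (R : realType) (V W : normedModType R)
    (U : set V) (f : V -> W) : Prop := forall k, Ck_on k U f.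

Record chart (R : realType) (n : nat) (M : topologicalType) := Chart {
  cdom : set M;
  cmap : M -> 'rV[R]_n;
  cinv : 'rV[R]_n -> M;
  cdom_open : open cdom;
  cimg_open : open (cmap @` cdom);
  cmapK : {in cdom, cancel cmap cinv};
  cmap_continuous : {in cdom, continuous cmap};
  cinv_continuous : {in cmap @` cdom, continuous cinv} }.

Definition cimg (R : realType) (n : nat) (M : topologicalType)
  (c : chart R n M) : set 'rV[R]_n := cmap c @` cdom c.

HB.mixin Record isLieGroup (R : realType) (n : nat) G
    of Group G & Topological G := {
  lie_hausdorff : hausdorff_space G;
  lie_second_countable : @second_countable G;
  atlas : set (chart R n G);
  atlas_cover : forall x : G, exists2 c, atlas c & cdom c x;
  atlas_smooth : forall c d, atlas c -> atlas d ->
    smooth_on (cmap c @` (cdom c `&` cdom d)) (cmap d \o cinv c);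
  mulg_continuous : continuous (fun p : G * G => (p.1 * p.2)%g);
  mulg_smooth : forall c d e, atlas c -> atlas d -> atlas e ->
    smooth_on
      [set z : 'rV[R]_n * 'rV[R]_n | [/\ cimg c z.1, cimg d z.2 &
                                 cdom e (cinv c z.1 * cinv d z.2)%g]]
      (fun z => cmap e (cinv c z.1 * cinv d z.2)%g);
  invg_continuous : continuous (fun x : G => x^-1%g);
  invg_smooth : forall c d, atlas c -> atlas d ->
    smooth_on [set z : 'rV[R]_n | cimg c z /\ cdom d (cinv c z)^-1%g]
      (fun z => cmap d (cinv c z)^-1%g) }.

#[short(type="lieGroupType")]
HB.structure Definition LieGroup (R : realType) (n : nat) :=
  {G of isLieGroup R n G & Group G & Topological G}.

Section LieTheory.
Context (R : realType) (n : nat) (G : lieGroupType R n).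

Definition smooth_near1 (f : G -> R) : Prop :=
  exists U : set G, [/\ open U, U 1%g &
    forall c, @atlas R n G c ->
      smooth_on (W := R^o) (cmap c @` (U `&` cdom c)) (f \o cinv c)].

Definition smooth_curve (eps : R) (gamma : R^o -> G) : Prop :=
  {in [set t : R^o | `|t| < eps], continuous gamma} /\
  forall c, @atlas R n G c ->
    smooth_on [set t : R^o | `|t| < eps /\ cdom c (gamma t)] (cmap c \o gamma).

(* Tangent vectors at 1 are represented by their action on germs at 1 of smooth
   functions; the value 0 on the other functions makes equality of tangent
   vectors the same as equality of functionals. *)
Definition tangent_vector : Type := (G -> R) -> R.

Definition on_germs (v : tangent_vector) : tangent_vector :=
  fun f => if `[< smooth_near1 f >] then v f else 0.

Definition velocity (gamma : R^o -> G) : tangent_vector :=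
  on_germs (fun f => derive1 (f \o gamma : R -> R^o) 0).

(* The Lie algebra of a subgroup H, as the tangent space at 1 of the subset H:
   the velocities at 0 of the smooth curves of G through 1 that stay in H.  When
   H is closed, hence an embedded Lie subgroup, this is the image in T_1 G of the
   tangent space at 1 of the manifold H; H := setT gives the Lie algebra of G. *)
Definition lie_algebra (H : set G) : set tangent_vector :=
  [set v | exists eps gamma, [/\ 0 < eps, smooth_curve eps gamma,
     gamma 0 = 1%g, (forall t, `|t| < eps -> H (gamma t)) &
     v = velocity gamma]].

(* The differential at 1 of x |-> g x g^-1. *)
Definition Ad (g : G) (xi : tangent_vector) : tangent_vector :=
  fun f => xi (fun x => f (g * x * g^-1)%g).

(* The left-invariant vector field with value xi at 1, acting on functions. *)
Definition left_field (xi : tangent_vector) (f : G -> R) : G -> R :=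
  fun x => xi (fun y => f (x * y)%g).

(* The value at 1 of the commutator of the left-invariant vector fields. *)
Definition lie_bracket (xi eta : tangent_vector) : tangent_vector :=
  on_germs (fun f => xi (left_field eta f) - eta (left_field xi f)).

Definition ad (xi : tangent_vector) : tangent_vector -> tangent_vector :=
  lie_bracket xi.

Definition CM (xi : tangent_vector) : set G := [set g | Ad g xi = xi].

End LieTheory.

(* Main.v *)
(* Read everything in a chart c at 1, with p the coordinates of 1.  A vector a
   at p spreads to a left-invariant field X_a and a right-invariant field Z_a,
   and g fixes the tangent vector a under Ad exactly when X_a and Z_a agree at
   g.  Differentiating this equality along a curve in the centralizer gives one
   inclusion, by symmetry of second derivatives.  Conversely, if the bracket of
   a and b vanishes, let y be an integral curve of X_b through p.  Left- and
   right-invariant fields always commute and X_a commutes with X_b, so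
   X_a(y) - Z_a(y) solves the linear equation d' = DX_b(y) d; it vanishes at 0,
   hence near 0, and y stays in the centralizer. *)

Require Import Defs.
From HB Require Import structures.
From mathcomp Require Import all_boot all_order all_algebra.
From mathcomp Require Import all_classical all_reals all_analysis.
From mathcomp Require Import ring lra.

Set Implicit Arguments.
Unset Strict Implicit.
Unset Printing Implicit Defensive.
Import Order.TTheory GRing.Theory Num.Theory.
Import numFieldNormedType.Exports.
Local Open Scope classical_set_scope.
Local Open Scope ring_scope.

(** * Directional derivatives *)

Section DirectionalDerivative.
Variables (R : realType).
Implicit Types (V W Z : normedModType R).

(** Everything happens near the identity, because [lie_algebra] asks only for a curve on some small
    interval. An integral curve from a local existence theorem therefore does the work of the
    exponential map, and the closed subgroup theorem does not enter.

    The fields X_a and Z_a are the derivatives at the identity of the group law [chart_mul] in its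
    second and first slot. They are kept as directional derivatives on the product space, so that
    commutation comes from associativity and the symmetry of second derivatives.

    Tangent vectors are functionals. An equation between them reaches coordinates by testing on the
    coordinate functions of the chart, and the way back must also treat functions that are not
    smooth near 1, where the value is 0 by convention.

    [Ck_on] speaks of directional derivatives only. The chain rule, the differentiability of C^1
    maps and Schwarz's theorem are derived from it, with finite dimension entering through
    [has_coords], which products inherit. *)

Lemma is_derive_line V W (f : V -> W) (x v : V) (s : R) (d : W) :
  is_derive (x + s *: v) v f d -> is_derive s 1 (fun t : R => f (x + t *: v)) d.
Proof.
have E : (fun h : R => h^-1 *: ((f \o shift (x + s *: v)) (h *: v) - f (x + s *: v)))
  = (fun h : R => h^-1 *: (((fun t : R => f (x + t *: v)) \o shift s) (h *: (1 : R))
      - f (x + s *: v))).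
  apply/funext => h /=; congr (_ *: (f _ - _)).
  by rewrite [h%:A]mulr1 scalerDl addrCA.
by case=> dv dE; split; [rewrite /derivable -E|rewrite /derive -E].
Qed.

Lemma is_derive_line0 V W (f : V -> W) (x v : V) (d : W) :
  is_derive (0 : R) 1 (fun t : R => f (x + t *: v)) d <-> is_derive x v f d.
Proof.
have E : (fun h : R => h^-1 *: ((f \o shift x) (h *: v) - f x))
  = (fun h : R => h^-1 *: (((fun t : R => f (x + t *: v)) \o shift 0) (h *: (1 : R))
      - f (x + 0 *: v))).
  apply/funext => h /=; congr (_ *: (f _ - f _)).
    by rewrite [h%:A]mulr1 addr0 addrC.
  by rewrite scale0r addr0.
by split=> -[dv dE]; split; move: dv dE; rewrite /derivable /derive E.
Qed.

(** Here f is derivable in one direction only. Restricted to the line through x along v it becomes a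
    differentiable function of one variable, and the usual chain rule applies there. *)
Lemma is_derive_comp V W Z (f : V -> W) (g : W -> Z) x v d :
  is_derive x v f d -> differentiable g (f x) ->
  is_derive x v (g \o f) ('D_d g (f x)).
Proof.
move=> /is_derive_line0 [/derivable1_diffP df <-] dg.
apply/is_derive_line0.
set c := fun t : R => f (x + t *: v) in df *.
have c0 : c 0 = f x by rewrite /c scale0r addr0.
have dgc : differentiable g (c 0) by rewrite c0.
have dgf : differentiable (g \o c) 0 by exact: differentiable_comp.
split; first exact/derivable1_diffP.
by rewrite (deriveE _ dgf) diff_comp//= (deriveE _ df) -c0 (deriveE _ dgc).
Qed.

Lemma is_derive_lin V W Z (f : V -> W) (L : {linear W -> Z}) x v d :
  continuous L -> is_derive x v f d -> is_derive x v (L \o f) (L d).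
Proof.
move=> cL df; have dL : differentiable L (f x) by exact: linear_differentiable.
by apply: is_derive_eq (is_derive_comp df dL) _; rewrite deriveE// diff_lin.
Qed.

Lemma derivable_line_continuous V W (f : V -> W) x v :
  derivable f x v -> {for (0 : R), continuous (fun t : R => f (x + t *: v))}.
Proof.
move=> /derivableP/is_derive_line0 [+ _].
by move=> /derivable1_diffP/differentiable_continuous.
Qed.

Lemma is_derive_scale V W (k : V -> R^o) (f : V -> W) x v dk df :
  is_derive x v k dk -> is_derive x v f df ->
  is_derive x v (fun y => k y *: f y) (k x *: df + dk *: f x).
Proof.
move=> [kv <-] [fv <-].
suff H : (fun h : R => h^-1 *: (((fun y => k y *: f y) \o shift x) (h *: v)
    - k x *: f x)) @ 0^' --> k x *: 'D_v f x + 'D_v k x *: f x.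
  by split; [apply/cvg_ex; eexists; exact: H|exact: cvg_lim H].
have -> : (fun h : R => h^-1 *: (((fun y => k y *: f y) \o shift x) (h *: v)
    - k x *: f x)) =
  (fun h : R => k (x + h *: v) *: (h^-1 *: ((f \o shift x) (h *: v) - f x))
   + (h^-1 *: ((k \o shift x) (h *: v) - k x)) *: f x).
  apply/funext => h /=; rewrite ![h *: v + x]addrC.
  rewrite [h^-1 *: (k _ - _)]mulrBr scalerBl !scalerBr !scalerA.
  by rewrite [k (x + _) * h^-1]mulrC addrA subrK.
apply: cvgD; last exact: cvgZr_tmp kv.
apply: cvgZ; last exact: fv.
(* The factor k is evaluated at the moving point; derivability along v gives its continuity along
   the line, which is all this limit uses. *)
have := derivable_line_continuous kv.
by move=> /continuous_withinNx; rewrite scale0r addr0.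
Qed.

Lemma deriveZv V W (f : V -> W) x v (t : R) :
  derivable f x v -> is_derive x (t *: v) f (t *: 'D_v f x).
Proof.
move=> /derivableP/is_derive_line0 [/derivable1_diffP df dE].
apply/is_derive_line0.
have -> : (fun s : R => f (x + s *: (t *: v))) =
    (fun t : R => f (x + t *: v)) \o ( *%R^~ t : R -> R).
  by apply/funext => s /=; rewrite scalerA.
have D : is_derive (0 : R) (1 : R) ( *%R^~ t : R -> R) t.
  have -> : ( *%R^~ t : R -> R) = (t \*: (@id R)) by apply/funext => s /=; rewrite mulrC.
  by apply: is_derive_eq; rewrite [_ *: _]mulr1.
apply: is_derive_eq; first by apply: (is_derive_comp D); rewrite mul0r.
rewrite /= mul0r -dE (deriveE _ df) (deriveE _ df).
by rewrite -[in LHS](mulr1 t) linearZ.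
Qed.

Lemma MVT_line V (f : V -> R^o) (x v : V) :
  (forall s : R, 0 <= s <= 1 -> derivable f (x + s *: v) v) ->
  exists2 s : R, 0 <= s <= 1 & f (x + v) - f x = 'D_v f (x + s *: v).
Proof.
move=> df; pose F := fun t : R => f (x + t *: v) : R.
have dF (t : R) : 0 <= t <= 1 -> is_derive t 1 F ('D_v f (x + t *: v)).
  by move=> t01; apply/is_derive_line/derivableP/df.
have [|||s] := @MVT_segment R F (fun t => 'D_v f (x + t *: v)) 0 1.
- by [].
- by move=> t /[!in_itv]/= /andP[t0 t1]; apply: dF; rewrite !ltW.
- apply: derivable_within_continuous => t /[!in_itv]/= t01.
  by have [] := dF _ t01.
- rewrite in_itv/= => s01; rewrite subr0 mulr1 /F scale1r scale0r addr0.
  by exists s.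
Qed.

End DirectionalDerivative.

(** * Finite-dimensional spaces through continuous coordinate forms *)

Section FiniteCoordinates.
Variable R : realType.

(* Finite dimension, in the only form needed; the coordinate forms must be assumed
   continuous because V is an arbitrary normed module. *)
Definition has_coords (V : normedModType R) := exists m (e : 'I_m -> V)
  (l : 'I_m -> {linear V -> R^o}),
  (forall i, continuous (l i)) /\ forall v, v = \sum_i l i v *: e i.

Lemma coords_eq (V : normedModType R) m (e : 'I_m -> V) (l : 'I_m -> {linear V -> R^o}) :
  (forall v, v = \sum_i l i v *: e i) ->
  forall v w, (forall i, l i v = l i w) -> v = w.
Proof.
move=> le v w H; rewrite [LHS]le [RHS]le; apply: eq_bigr => i _.
by rewrite H.
Qed.

Lemma has_coords_R : has_coords R^o.
Proof.
exists 1%N, (fun=> 1), (fun=> (@idfun R^o : {linear R^o -> R^o})).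
split=> [i x|v]; first exact: cvg_id.
by rewrite big_ord1; rewrite /= [_ *: _]mulr1.
Qed.

Lemma has_coords_rV n : has_coords 'rV[R]_n.
Proof.
pose c (i : 'I_n) (v : 'rV[R]_n) : R^o := v ord0 i.
have cl i : linear (c i) by move=> a u v; rewrite /c !mxE.
pose L i : {linear 'rV[R]_n -> R^o} :=
  HB.pack (c i) (GRing.isLinear.Build _ _ _ _ _ (cl i)).
exists n, (delta_mx ord0), L; split=> [i|v]; first exact: coord_continuous.
by rewrite [LHS]row_sum_delta.
Qed.

Lemma has_coords_prod (V W : normedModType R) :
  has_coords V -> has_coords W -> has_coords (V * W)%type.
Proof.
move=> [m [e [l [cl le]]]] [m' [e' [l' [cl' le']]]].
pose E (i : 'I_(m + m')) : V * W :=
  match fintype.split i with inl j => (e j, 0) | inr j => (0, e' j) end.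
pose c (i : 'I_(m + m')) (v : V * W) : R^o :=
  match fintype.split i with inl j => l j v.1 | inr j => l' j v.2 end.
have c_lin i : linear (c i).
  by move=> a u v; rewrite /c; case: fintype.split => j /=; rewrite linearP.
pose L i : {linear (V * W)%type -> R^o} :=
  HB.pack (c i) (GRing.isLinear.Build _ _ _ _ _ (c_lin i)).
exists (m + m')%N, E, L; split=> [i|v].
  rewrite /= /c; case: fintype.split => j x.
    by apply: continuous_comp; [exact: cvg_fst|exact: cl].
  by apply: continuous_comp; [exact: cvg_snd|exact: cl'].
rewrite big_split_ord/= /E /c.
under eq_bigr do rewrite (unsplitK (inl _)).
under [X in _ + X]eq_bigr do rewrite (unsplitK (inr _)).
have sum1 (k : nat) (F : 'I_k -> V * W) : \sum_i F i = (\sum_i (F i).1, \sum_i (F i).2).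
  elim/big_rec3: _ => //= i a b c' _ ->; by case: (F i).
rewrite !sum1/= [v in LHS]surjective_pairing; congr (_, _).
- rewrite [X in _ + X]big1 ?addr0; first exact: le.
  by move=> i _; rewrite scaler0.
- rewrite [X in X + _]big1 ?add0r; first exact: le'.
  by move=> i _; rewrite scaler0.
Qed.

End FiniteCoordinates.

(** * Functions of class C^k *)

Section Ck.
Variable R : realType.
Implicit Types (V W Z : normedModType R) (k : nat).

Lemma Ck_on_continuous V W k (U : set V) (f : V -> W) :
  Ck_on k U f -> {in U, continuous f}.
Proof. by case: k => [|k] []. Qed.

Lemma Ck_onW V W k (U : set V) (f : V -> W) : Ck_on k.+1 U f -> Ck_on k U f.
Proof.
elim: k f => [|k IH] f; first by case.
by case=> cf df; split=> // v; have [dv /IH] := df v.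
Qed.

Lemma Ck_on_sub V W k (U U' : set V) (f : V -> W) : U' `<=` U ->
  Ck_on k U f -> Ck_on k U' f.
Proof.
move=> UU'; elim: k f => [|k IH] f.
  by case=> cf _; split=> // x /[!inE] /UU' Ux; apply: cf; rewrite inE.
case=> cf df; split=> [x /[!inE] /UU' Ux|v]; first by apply: cf; rewrite inE.
have [dv /IH ?] := df v; split=> // x /[!inE] /UU' Ux.
by apply: dv; rewrite inE.
Qed.

Lemma open_near V (U : set V) x : open U -> U x -> \forall y \near x, U y.
Proof. by move=> oU Ux; exact: open_nbhs_nbhs. Qed.

(** Openness of U makes f and g agree near each of its points, so their derivatives agree on U and
    the induction goes on. *)
Lemma Ck_on_eq V W k (U : set V) (f g : V -> W) : open U ->
  {in U, f =1 g} -> Ck_on k U f -> Ck_on k U g.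
Proof.
move=> oU; elim: k f g => [|k IH] f g fg.
  move=> [cf _]; split=> // x xU; have Ux : U x by rewrite inE in xU.
  have E : \forall y \near x, f y = g y.
    by apply: filterS (open_near oU Ux) => y Uy; apply: fg; rewrite inE.
  rewrite /prop_for /continuous_at -fg//.
  by apply: cvg_trans (cf _ xU); apply: near_eq_cvg; apply: filterS E.
move=> Ckf.
have E x : x \in U -> \forall y \near x, f y = g y.
  rewrite inE => Ux.
  by apply: filterS (open_near oU Ux) => y Uy; apply: fg; rewrite inE.
split.
  move=> x xU; rewrite /prop_for /continuous_at -fg//.
  apply: cvg_trans (Ck_on_continuous Ckf xU); apply: near_eq_cvg.
  exact: E.
move=> v; case: Ckf => _ /(_ v) [dv Ckv]; split.
  by move=> x xU; apply: near_eq_derivable (dv _ xU); exact: E.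
apply: IH Ckv => x xU; apply: near_eq_derive; exact: E.
Qed.

Lemma Ck_on_cst V W k (U : set V) (c : W) : Ck_on k U (cst c : V -> W).
Proof.
elim: k c => [|k IH] c; first by split=> // x _; exact: cvg_cst.
split=> [x _|v]; first exact: cvg_cst.
split=> [x _|]; first exact: derivable_cst.
have -> : (fun x : V => 'D_v (cst c) x) = cst 0 by apply/funext => x; exact: derive_cst.
exact: IH.
Qed.

Lemma Ck_on_lin V W Z k (U : set V) (f : V -> W) (L : {linear W -> Z}) :
  continuous L -> open U -> Ck_on k U f -> Ck_on k U (L \o f).
Proof.
move=> cL oU; elim: k f => [|k IH] f.
  by move=> [cf _]; split=> // x /cf cfx; apply: continuous_comp; [exact: cfx|exact: cL].
move=> [cf df]; split=> [x /cf cfx|v].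
  by apply: continuous_comp; [exact: cfx|exact: cL].
have [dv Ckv] := df v; have dLf x : x \in U -> is_derive x v (L \o f) (L ('D_v f x)).
  by move=> /dv/derivableP; exact: is_derive_lin.
split=> [x /dLf[]//|].
by apply: Ck_on_eq (IH _ Ckv) => // x /dLf[].
Qed.

Lemma Ck_on_id V k (U : set V) : Ck_on k U (@id V).
Proof.
case: k => [|k]; first by split=> // x _; exact: cvg_id.
split=> [x _|v]; first exact: cvg_id.
split=> [x _|]; first exact: derivable_id.
have -> : (fun x => 'D_v (@id V) x) = cst v by apply/funext => x; exact: derive_id.
exact: Ck_on_cst.
Qed.

Lemma Ck_onD V W k (U : set V) (f g : V -> W) : open U ->
  Ck_on k U f -> Ck_on k U g -> Ck_on k U (f + g).
Proof.
move=> oU; elim: k f g => [|k IH] f g.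
  move=> [cf _] [cg _]; split=> // x xU.
  exact: cvgD (cf _ xU) (cg _ xU).
move=> [cf df] [cg dg]; split=> [x xU|v].
  exact: cvgD (cf _ xU) (cg _ xU).
have [dfv Ckf] := df v; have [dgv Ckg] := dg v; split=> [x xU|].
  exact: derivableD (dfv _ xU) (dgv _ xU).
apply: Ck_on_eq (IH _ _ Ckf Ckg) => // x xU.
by rewrite deriveD//; [exact: dfv|exact: dgv].
Qed.

Lemma Ck_onZ V W k (U : set V) (a : V -> R^o) (f : V -> W) : open U ->
  Ck_on k U a -> Ck_on k U f -> Ck_on k U (fun x => a x *: f x).
Proof.
move=> oU; elim: k a f => [|k IH] a f.
  move=> [ca _] [cf _]; split=> // x xU.
  exact: cvgZ (ca _ xU) (cf _ xU).
move=> Cka Ckf; have := Ck_onW Cka; have := Ck_onW Ckf.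
move: Cka Ckf => [ca da] [cf df] Ckf Cka; split=> [x xU|v].
  exact: cvgZ (ca _ xU) (cf _ xU).
have [dav Ckav] := da v; have [dfv Ckfv] := df v.
have D x : x \in U -> is_derive x v (fun x => a x *: f x)
    (a x *: 'D_v f x + 'D_v a x *: f x).
  by move=> xU; apply: is_derive_scale; apply: derivableP; [exact: dav|exact: dfv].
split=> [x /D[]//|].
apply: Ck_on_eq (Ck_onD oU (IH _ _ Cka Ckfv) (IH _ _ Ckav Ckf)) => // x.
by move=> /D[].
Qed.

Lemma Ck_on_sum V W k (U : set V) m (f : 'I_m -> V -> W) : open U ->
  (forall i, Ck_on k U (f i)) -> Ck_on k U (fun x => \sum_i f i x).
Proof.
move=> oU Ckf; have -> : (fun x => \sum_i f i x) = \sum_i f i.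
  by apply/funext => x; rewrite fct_sumE.
elim/big_ind: _ => //; first exact: Ck_on_cst.
by move=> ? ? ? ?; exact: Ck_onD.
Qed.

(* The mean value theorem turns the increment along v into a value of 'D_v f near x. *)
Lemma deriveDv V (U : set V) (f : V -> R^o) u v x : open U ->
  (forall y w, U y -> derivable f y w) -> U x -> {for x, continuous ('D_v f)} ->
  'D_(u + v) f x = 'D_u f x + 'D_v f x.
Proof.
move=> oU df Ux cDv; apply: cvg_lim => //.
have [r r0 rU] : exists2 r : R, 0 < r & forall y, `|x - y| < r -> U y.
  have /nbhs_ballP[r r0 rU] := open_near oU Ux.
  by exists r => // y yr; apply: rU; rewrite -ball_normE.
(* The summand 1 in the denominator keeps it positive when u and v both vanish. *)
have small (h : R) : `|h| < r / (`|u| + `|v| + 1) -> `|h| * (`|u| + `|v|) < r.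
  have N : 0 <= `|u| + `|v| by exact: addr_ge0.
  rewrite ltr_pdivlMr; last by lra.
  by apply: le_lt_trans; rewrite ler_wpM2l//; lra.
have near_in (h s : R) : `|h| < r / (`|u| + `|v| + 1) -> 0 <= s <= 1 ->
    `|x - (x + h *: u + s *: (h *: v))| <= `|h| * (`|u| + `|v|).
  move=> hr /andP[s0 s1].
  rewrite -addrA opprD addrA subrr add0r normrN scalerA.
  apply: le_trans (ler_normD _ _) _; rewrite !normrZ mulrDr lerD2l ler_wpM2r//.
  by rewrite ?normrM (ger0_norm s0) ler_piMl.
have r'0 : 0 < r / (`|u| + `|v| + 1).
  by rewrite divr_gt0//; have := normr_ge0 u; have := normr_ge0 v; lra.
have /choice[theta thetaP] : forall h : R, exists s : R, `|h| < r / (`|u| + `|v| + 1) ->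
    0 <= s <= 1 /\
    f (x + h *: u + h *: v) - f (x + h *: u) = h *: 'D_v f (x + h *: u + s *: (h *: v)).
  move=> h; have [hr|] := ltP `|h| (r / (`|u| + `|v| + 1)); last by exists 0.
  have Us (s : R) : 0 <= s <= 1 -> U (x + h *: u + s *: (h *: v)).
    by move=> s01; apply: rU; apply: le_lt_trans (near_in _ _ hr s01) (small _ hr).
  have [s s01 sE] := @MVT_line R V f (x + h *: u) (h *: v) (fun s s01 => df _ _ (Us s s01)).
  exists s => _; split=> //; rewrite sE.
  by have [_ ->] := deriveZv h (df _ v (Us _ s01)).
have hsmall : \forall h \near (0 : R)^', `|h| < r / (`|u| + `|v| + 1).
  exact: dnbhs0_lt.
have cvg1 : x + h *: u + theta h *: (h *: v) @[h --> (0 : R)^'] --> x.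
  apply/cvgrPdist_lt => e e0; near=> h.
  have hr : `|h| < r / (`|u| + `|v| + 1) by near: h.
  have [t01 _] := thetaP _ hr.
  apply: le_lt_trans (near_in _ _ hr t01) _.
  apply: (@le_lt_trans _ _ (`|h| * (`|u| + `|v| + 1))).
    by rewrite ler_wpM2l//; lra.
  rewrite -ltr_pdivlMr; last by have := normr_ge0 u; have := normr_ge0 v; lra.
  near: h; apply: dnbhs0_lt.
  by rewrite divr_gt0//; have := normr_ge0 u; have := normr_ge0 v; lra.
rewrite ['D_u f x + _]addrC.
have A : 'D_v f (x + h *: u + theta h *: (h *: v)) @[h --> (0 : R)^'] --> 'D_v f x.
  exact: cvg_comp cvg1 cDv.
have /(_ (dnbhs_filter (0 : R))) H := cvgD A (df x u Ux).
apply: cvg_trans H.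
apply: near_eq_cvg; near=> h.
have hr : `|h| < r / (`|u| + `|v| + 1) by near: h.
have h0 : h != 0 by near: h; exact: nbhs_dnbhs_neq.
have [_ E] := thetaP _ hr.
rewrite -[LHS]/('D_v f (x + h *: u + theta h *: (h *: v)) +
  h^-1 *: (f (h *: u + x) - f x)).
have -> : 'D_v f (x + h *: u + theta h *: (h *: v)) =
    h^-1 *: (f (x + h *: u + h *: v) - f (x + h *: u)).
  by rewrite E (scalerA h^-1 h) mulVf// scale1r.
have K (a b c : R) : a - b + (b - c) = a - c by ring.
by rewrite -scalerDr [h *: u + x]addrC /= (scalerDr h) [_ + x]addrC (addrA x); congr (_ *: _); exact: K.
Unshelve. all: by end_near. Qed.

Lemma derive_sumv V (U : set V) (f : V -> R^o) x m (a : 'I_m -> R) (e : 'I_m -> V) :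
  open U -> Ck_on 1 U f -> U x ->
  'D_(\sum_i a i *: e i) f x = \sum_i a i *: 'D_(e i) f x.
Proof.
move=> oU [_ Ckf] Ux.
have df y w : U y -> derivable f y w.
  by move=> Uy; have [+ _] := Ckf w; apply; rewrite inE.
have cD w : {for x, continuous ('D_w f)}.
  by have [_ [+ _]] := Ckf w; apply; rewrite inE.
elim: m a e => [|m IH] a e; first by rewrite !big_ord0 derive0.
rewrite !big_ord_recr/= (deriveDv _ oU df Ux (cD _)) IH.
by have [_ ->] := deriveZv (a ord_max) (df _ (e ord_max) Ux).
Qed.

(** The candidate differential combines the derivatives along the basis with the coordinates of v.
    The mean value theorem replaces the increment along h by ['D_h f] at a point of the segment, and
    continuity of the derivatives along the basis compares this with the candidate at x. *)
Lemma Ck1_differentiable_real V (U : set V) (f : V -> R^o) x :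
  has_coords V -> open U -> Ck_on 1 U f -> U x -> differentiable f x.
Proof.
move=> [m [e [l [cl le]]]] oU Ckf Ux.
have df y w : U y -> derivable f y w.
  by move=> Uy; have [+ _] := (Ckf.2 w); apply; rewrite inE.
pose D (v : V) : R^o := \sum_i l i v *: 'D_(e i) f x.
have D_lin : linear D.
  move=> a u v; rewrite /D scaler_sumr -big_split/=; apply: eq_bigr => i _.
  by rewrite linearP scalerDl scalerA.
pose L : {linear V -> R^o} := HB.pack D (GRing.isLinear.Build _ _ _ _ _ D_lin).
have cL : continuous L.
  suff [cD _] : Ck_on 0 setT D by move=> v; apply: cD; rewrite inE.
  apply: Ck_on_sum => [|i]; first exact: openT.
  by split=> // v _; apply: cvgZr_tmp; exact: cl.
suff H : f \o shift x = cst (f x) + L +o_ 0 id.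
  by apply/diff_locallyP; rewrite (diff_unique cL H).
apply/eqaddoP => _/posnumP[eps].
have [C C0 CP] : exists2 C : R, 0 < C & forall i v, `|l i v| <= C * `|v|.
  have F i : exists2 C : R, 0 < C & forall v, `|l i v| <= C * `|v|.
    exact: linear_lipschitz.
  exists (1 + \sum_i projT1 (cid2 (F i))) => [|i v].
    rewrite ltr_pwDl// sumr_ge0// => i _; case: cid2 => //= c /ltW//.
  have := projT2 (cid2 (F i)); case=> c0 /(_ v); move=> H; apply: le_trans H _.
  rewrite ler_wpM2r// (bigD1 i)//= addrCA lerDl addr_ge0// sumr_ge0// => j _.
  by case: cid2 => //= c /ltW.
(* Each of the m coordinates of h costs a factor C, so the errors add up to at most eps times the
   norm of h; [m.+1] in place of m covers dimension 0. *)
have : \forall y \near x, U y /\ forall i, `|'D_(e i) f x - 'D_(e i) f y| < eps%:num / (C * m.+1%:R).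
  near=> y; split; first by near: y; exact: open_near.
  near: y; apply: filter_forall => i.
  have [_ [+ _]] := Ckf.2 (e i); move=> /(_ x); rewrite inE => /(_ Ux).
  by move=> /cvgrPdist_lt; apply; rewrite divr_gt0// mulr_gt0.
move=> /nbhs_ballP[r /= r0 rP]; apply/nbhs_ballP; exists r => //= h.
rewrite -ball_normE/= sub0r normrN => hr.
have Us (s : R) : 0 <= s <= 1 -> ball x r (x + s *: h).
  move=> /andP[s0 s1]; rewrite -ball_normE/= opprD addrA subrr add0r normrN.
  by rewrite normrZ (ger0_norm s0); apply: le_lt_trans hr; rewrite ler_piMl.
have [s s01 sE] := @MVT_line R V f x h (fun s s01 => df _ _ (rP _ (Us _ s01)).1).
rewrite -![(_ + _ : _ -> _) _]/(_ + _) -![(- _ : _ -> _) _]/(- _).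
rewrite /= [h + x]addrC opprD addrA sE /D.
have [Us' Es'] := rP _ (Us _ s01).
rewrite [X in 'D_X f _]le (derive_sumv _ _ oU Ckf Us') -sumrB.
apply: (@le_trans _ _ (\sum_(i < m) eps%:num / m.+1%:R * `|h|)).
  apply: le_trans (ler_norm_sum _ _ _) _; apply: ler_sum => i _.
  rewrite -scalerBr normrZ.
  apply: (@le_trans _ _ ((C * `|h|) * (eps%:num / (C * m.+1%:R)))).
    by apply: ler_pM => //; rewrite distrC ltW.
  rewrite le_eqVlt; apply/orP; left; apply/eqP.
  have : m.+1%:R != 0 :> R by rewrite pnatr_eq0.
  by move: (m.+1%:R : R) => M M0; field; rewrite M0 gt_eqF.
rewrite sumr_const card_ord -mulrnAl ler_wpM2r//.
rewrite -[_ *+ m]mulr_natr -mulrA ler_piMr// mulrC ler_pdivrMr// mul1r.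
by rewrite ler_nat.
Unshelve. all: by end_near. Qed.

End Ck.

(** * Chain rule, smoothness at a point, and symmetry of second derivatives *)

Section Smooth.
Variable R : realType.
Implicit Types (V W Z : normedModType R) (k : nat).

Lemma Ck1_differentiable V W (U : set V) (f : V -> W) x :
  has_coords V -> has_coords W -> open U -> Ck_on 1 U f -> U x -> differentiable f x.
Proof.
move=> cV [m [e [l [cl le]]]] oU Ckf Ux.
have -> : f = \sum_i (fun x => l i (f x) *: e i).
  by apply/funext => y; rewrite fct_sumE; exact: le.
apply: differentiable_sum => i; apply: differentiableZl.
apply: (@Ck1_differentiable_real _ _ U (l i \o f)) => //.
exact: Ck_on_lin.
Qed.

Lemma derive_coords V W (f : V -> W) x m (a : 'I_m -> R) (e : 'I_m -> V) :
  differentiable f x -> 'D_(\sum_i a i *: e i) f x = \sum_i a i *: 'D_(e i) f x.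
Proof.
move=> df; rewrite deriveE// linear_sum; apply: eq_bigr => i _.
by rewrite linearZ deriveE.
Qed.

(** The derivative of the composite is g differentiated in the direction ['D_v f x], which moves
    with x. Expanding this direction in coordinates of W leaves fixed directions [e i] with scalar
    coefficients, so the product rule and the induction hypothesis for ['D_(e i) g] apply. *)
Lemma Ck_on_comp V W Z k (U : set V) (U' : set W) (f : V -> W) (g : W -> Z) :
  has_coords W -> has_coords Z -> open U -> open U' ->
  (forall x, U x -> U' (f x)) ->
  Ck_on k U f -> Ck_on k U' g -> Ck_on k U (g \o f).
Proof.
move=> cW cZ oU oU' UU'; elim: k f g UU' => [|k IH] f g UU' Ckf Ckg.
  split=> // x xU; have Ux : U x by rewrite inE in xU.
  apply: continuous_comp; first exact: Ckf.1.
  by apply: Ckg.1; rewrite inE; exact: UU'.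
split=> [x xU|v].
  have Ux : U x by rewrite inE in xU.
  apply: continuous_comp; first exact: Ckf.1.
  by apply: Ckg.1; rewrite inE; exact: UU'.
have Ck1g : Ck_on 1 U' g.
  by elim: (k) Ckg => // j IHj /Ck_onW.
have dg y : U' y -> differentiable g y by move=> U'y; exact: Ck1_differentiable Ck1g U'y.
have [dfv Ckfv] := Ckf.2 v.
have D x : x \in U -> is_derive x v (g \o f) ('D_('D_v f x) g (f x)).
  move=> xU; apply: is_derive_comp; first exact/derivableP/dfv.
  by apply/dg/UU'; rewrite inE in xU.
split=> [x /D[]//|].
case: (cW) => [m [e [l [cl le]]]].
have : Ck_on k U (fun x => \sum_i (l i \o (fun x => 'D_v f x)) x *: ('D_(e i) g \o f) x).
  apply: Ck_on_sum => // i; apply: Ck_onZ => //; first exact: Ck_on_lin.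
  by apply: IH => //; [exact: Ck_onW|have [] := Ckg.2 (e i)].
apply: Ck_on_eq => // x xU; have [_ ->] := D _ xU.
rewrite [in RHS](le ('D_v f x)) derive_coords//.
by apply/dg/UU'; rewrite inE in xU.
Qed.

(** A single neighbourhood serves all orders at once, so that derivatives of f are again smooth at
    x. *)
Definition smooth_at V W (f : V -> W) (x : V) :=
  exists2 U, open_nbhs x U & smooth_on U f.

Lemma smooth_on_at V W (U : set V) (f : V -> W) x :
  open U -> smooth_on U f -> U x -> smooth_at f x.
Proof. by move=> oU sf Ux; exists U. Qed.

Lemma Ck_on_bigcup V W k (U : set V) (f : V -> W) :
  (forall x, U x -> exists U', [/\ open U', U' x & Ck_on k U' f]) -> Ck_on k U f.
Proof.
elim: k f => [|k IH] f H.
  split=> // x /[!inE] /H[U' [oU' U'x [cf _]]].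
  by apply: cf; rewrite inE.
split=> [x /[!inE] /H[U' [oU' U'x [cf _]]]|v]; first by apply: cf; rewrite inE.
split=> [x /[!inE] /H[U' [oU' U'x [_ /(_ v) [df _]]]]|]; first by apply: df; rewrite inE.
by apply: IH => x /H[U' [oU' U'x [_ /(_ v) [_ Ckf]]]]; exists U'.
Qed.

Lemma smooth_at_on V W (U : set V) (f : V -> W) :
  (forall x, U x -> smooth_at f x) -> smooth_on U f.
Proof.
move=> H k; apply: Ck_on_bigcup => x /H[U' [oU' U'x] sf].
by exists U'; split=> //; exact: sf.
Qed.

Lemma smooth_at_near V W (f : V -> W) x :
  smooth_at f x -> \forall y \near x, smooth_at f y.
Proof.
move=> [U [oU Ux] sf]; apply: filterS (open_near oU Ux) => y Uy.
by exists U.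
Qed.

Lemma smooth_at_continuous V W (f : V -> W) x : smooth_at f x -> {for x, continuous f}.
Proof.
by move=> [U [oU Ux] sf]; have [+ _] := sf 0%N; apply; rewrite inE.
Qed.

Lemma smooth_at_derivable V W (f : V -> W) x v : smooth_at f x -> derivable f x v.
Proof.
move=> [U [oU Ux] sf]; have [_ /(_ v) [+ _]] := sf 1%N; apply.
by rewrite inE.
Qed.

Lemma smooth_at_differentiable V W (f : V -> W) x :
  has_coords V -> has_coords W -> smooth_at f x -> differentiable f x.
Proof. by move=> cV cW [U [oU Ux] sf]; exact: Ck1_differentiable (sf 1%N) Ux. Qed.

Lemma smooth_at_derive V W (f : V -> W) x v : smooth_at f x -> smooth_at ('D_v f) x.
Proof.
move=> [U oUx sf]; exists U => // k.
by have [_ /(_ v) []] := sf k.+1.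
Qed.

Lemma near_open V (P : V -> Prop) x : (\forall y \near x, P y) ->
  exists U, [/\ open U, U x & forall y, U y -> P y].
Proof.
move=> /nbhs_ballP[r /= r0 rP]; exists (ball x r); split=> //.
- exact: ball_open.
- exact: ballxx.
Qed.

Lemma open_smooth_at V W (f : V -> W) :
  open [set x | smooth_at f x].
Proof. by rewrite openE => x sx; exact: smooth_at_near. Qed.

Lemma smooth_at_eq V W (f g : V -> W) x : (\forall y \near x, f y = g y) ->
  smooth_at f x -> smooth_at g x.
Proof.
move=> /near_open[U [oU Ux fg]] [U' [oU' U'x] sf].
have oUU' : open (U `&` U') by exact: openI.
exists (U `&` U') => // k; apply: (@Ck_on_eq _ _ _ _ _ f) => //.
  by move=> y /[!inE] -[Uy _]; exact: fg.
by apply: Ck_on_sub (sf k) => y [].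
Qed.

Lemma smooth_at_comp V W Z (f : V -> W) (g : W -> Z) x :
  has_coords W -> has_coords Z ->
  smooth_at f x -> smooth_at g (f x) -> smooth_at (g \o f) x.
Proof.
move=> cW cZ sf [U' [oU' U'x] sg].
have /near_open[U1 [oU1 U1x U1P]] : \forall y \near x, U' (f y).
  exact: smooth_at_continuous sf _ (open_near oU' U'x).
move: sf => [U [oU Ux] sf]; have oI : open (U1 `&` U) by exact: openI.
exists (U1 `&` U) => // k; apply: (@Ck_on_comp _ _ _ _ _ U') => //.
  by move=> y [/U1P].
by apply: Ck_on_sub (sf k) => y [].
Qed.

Lemma smooth_at_cst V W (c : W) (x : V) : smooth_at (cst c : V -> W) x.
Proof. by exists setT => [|k]; [split=> //; exact: openT|exact: Ck_on_cst]. Qed.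

Lemma smooth_at_id V (x : V) : smooth_at (@id V) x.
Proof. by exists setT => [|k]; [split=> //; exact: openT|exact: Ck_on_id]. Qed.

Lemma smooth_at_linear V W Z (L : {linear W -> Z}) (f : V -> W) x :
  continuous L -> smooth_at f x -> smooth_at (L \o f) x.
Proof.
by move=> cL [U [oU Ux] sf]; exists U => // k; exact: Ck_on_lin.
Qed.

Lemma smooth_atD V W (f g : V -> W) x :
  smooth_at f x -> smooth_at g x -> smooth_at (f + g) x.
Proof.
move=> [U [oU Ux] sf] [U' [oU' Ux'] sg].
have oI : open (U `&` U') by exact: openI.
exists (U `&` U') => // k; apply: Ck_onD => //.
  by apply: Ck_on_sub (sf k) => y [].
by apply: Ck_on_sub (sg k) => y [].
Qed.

(** The pair is the sum of f and g followed by the two linear injections into the product. *)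
Lemma smooth_at_pair V W Z (f : V -> W) (g : V -> Z) x :
  smooth_at f x -> smooth_at g x -> smooth_at (fun y => (f y, g y)) x.
Proof.
pose i1 (w : W) : W * Z := (w, 0); pose i2 (z : Z) : W * Z := (0, z).
have l1 : linear i1.
  by move=> a u v; rewrite /i1 -[a *: (u, 0)]/(a *: u, a *: 0) scaler0 -[RHS]/(_, 0 + 0) addr0.
have l2 : linear i2.
  by move=> a u v; rewrite /i2 -[a *: (0, u)]/(a *: 0, a *: u) scaler0 -[RHS]/(0 + 0, _) addr0.
pose L1 : {linear W -> (W * Z)%type} := HB.pack i1 (GRing.isLinear.Build _ _ _ _ _ l1).
pose L2 : {linear Z -> (W * Z)%type} := HB.pack i2 (GRing.isLinear.Build _ _ _ _ _ l2).
have c1 : continuous L1 by move=> w; apply: cvg_pair; [exact: cvg_id|exact: cvg_cst].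
have c2 : continuous L2 by move=> w; apply: cvg_pair; [exact: cvg_cst|exact: cvg_id].
move=> sf sg; have := smooth_atD (smooth_at_linear c1 sf) (smooth_at_linear c2 sg).
congr smooth_at; apply/funext => y.
by rewrite -[LHS]/(f y + 0, 0 + g y) addr0 add0r.
Qed.

Lemma is_derive_pair V W Z (f : V -> W) (g : V -> Z) x v df dg :
  is_derive x v f df -> is_derive x v g dg ->
  is_derive x v (fun y => (f y, g y)) (df, dg).
Proof.
move=> [fv <-] [gv <-].
suff H : (fun h : R => h^-1 *: (((fun y => (f y, g y)) \o shift x) (h *: v)
    - (f x, g x))) @ 0^' --> ('D_v f x, 'D_v g x).
  by split; [apply/cvg_ex; eexists; exact: H|exact: cvg_lim H].
exact: cvg_pair fv gv.
Qed.

Lemma is_derive_translate V W (f : V -> W) w y u d :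
  is_derive (y + w) u f d -> is_derive y u (fun z => f (z + w)) d.
Proof.
move=> /is_derive_line0 H; apply/is_derive_line0; move: H.
by under eq_fun do rewrite addrAC.
Qed.

(* By the mean value theorem applied twice, this second difference is a value of
   'D_v ('D_u f); it is symmetric in u and v, whence Schwarz's theorem. *)
Definition mixed_increment V (f : V -> R^o) x u v :=
  f (x + u + v) - f (x + u) - f (x + v) + f x.

Lemma mixed_incrementE V (U : set V) (f : V -> R^o) x u v : open U -> Ck_on 2 U f ->
  (forall s t : R, 0 <= s <= 1 -> 0 <= t <= 1 -> U (x + s *: u + t *: v)) ->
  exists s t : R, [/\ 0 <= s <= 1, 0 <= t <= 1 &
    mixed_increment f x u v = 'D_v ('D_u f) (x + s *: u + t *: v)].
Proof.
move=> oU Ckf Us.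
have df y w : U y -> derivable f y w.
  by move=> Uy; have [+ _] := Ckf.2 w; apply; rewrite inE.
have ddf y w w' : U y -> derivable ('D_w f) y w'.
  by move=> Uy; have [_ [_ /(_ w') [+ _]]] := Ckf.2 w; apply; rewrite inE.
have dg y : U y -> U (y + v) -> is_derive y u (fun z => f (z + v) - f z : R^o)
    ('D_u f (y + v) - 'D_u f y).
  move=> Uy Uyv; apply: (@is_deriveB _ _ _ (fun z => f (z + v))).
    exact/is_derive_translate/derivableP/df.
  exact/derivableP/df.
have U0 s : 0 <= s <= 1 -> U (x + s *: u).
  move=> s01; have := Us s 0 s01; rewrite scale0r addr0; apply.
  by rewrite lexx ler01.
have U1 s : 0 <= s <= 1 -> U (x + s *: u + v).
  move=> s01; have := Us s 1 s01; rewrite scale1r; apply.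
  by rewrite lexx ler01.
have [s s01 sE] := @MVT_line R V (fun z => f (z + v) - f z) x u
  (fun s s01 => let: DeriveDef p _ := dg _ (U0 _ s01) (U1 _ s01) in p).
have [t t01 tE] := @MVT_line R V ('D_u f) (x + s *: u) v
  (fun t t01 => ddf _ _ _ (Us _ _ s01 t01)).
exists s, t; split=> //; rewrite -tE /mixed_increment.
have [_ <-] := dg _ (U0 _ s01) (U1 _ s01); rewrite -sE.
have K (a b c d : R) : a - b - c + d = a - b - (c - d) by ring.
exact: K.
Qed.

Lemma mixed_incrementC V (f : V -> R^o) x u v :
  mixed_increment f x u v = mixed_increment f x v u.
Proof.
rewrite /mixed_increment [x + u + v]addrAC.
have K (a b c d : R) : a - b - c + d = a - c - b + d by ring.
exact: K.
Qed.

(** By contradiction. The mixed increment with steps h u and h v is h^2 times either mixed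
    derivative, each taken at some point close to x. Cancelling h^2 gives one number that is close
    to both sides. *)
Lemma derive_symmetric_real V (U : set V) (f : V -> R^o) x u v :
  open U -> Ck_on 2 U f -> U x -> 'D_u ('D_v f) x = 'D_v ('D_u f) x.
Proof.
move=> oU Ckf Ux.
have df y w : U y -> derivable f y w.
  by move=> Uy; have [+ _] := Ckf.2 w; apply; rewrite inE.
have ddf y w w' : U y -> derivable ('D_w f) y w'.
  by move=> Uy; have [_ [_ /(_ w') [+ _]]] := Ckf.2 w; apply; rewrite inE.
have cdd w w' : {for x, continuous ('D_w' ('D_w f))}.
  by have [_ [_ /(_ w') [_ [+ _]]]] := Ckf.2 w; apply; rewrite inE.
have scale2 (h : R) y w w' : U y ->
    'D_(h *: w') ('D_(h *: w) f) y = h *: (h *: 'D_w' ('D_w f) y).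
  move=> Uy.
  have E : \forall z \near y, (h \*: 'D_w f) z = 'D_(h *: w) f z.
    apply: filterS (open_near oU Uy) => z Uz.
    by have [_ ->] := deriveZv h (df _ w Uz).
  have D z : U z -> derivable (h \*: 'D_w f) z w' by move=> Uz; exact/derivableZ/ddf.
  rewrite -(near_eq_derive _ E).
  by have [_ ->] := deriveZv h (D _ Uy); rewrite deriveZ//; exact: ddf.
apply/eqP; apply: contraT => neq.
set A := 'D_u _ x in neq *; set B := 'D_v _ x in neq *.
(* With half the gap, no number lies within e of both A and B. *)
pose e := `|A - B| / 2.
have e0 : 0 < e by rewrite divr_gt0// normr_gt0 subr_eq0.
have nA : \forall y \near x, `|A - 'D_u ('D_v f) y| < e.
  by have /cvgrPdist_lt/(_ e e0) := cdd v u.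
have nB : \forall y \near x, `|B - 'D_v ('D_u f) y| < e.
  by have /cvgrPdist_lt/(_ e e0) := cdd u v.
have : \forall y \near x, [/\ U y, `|A - 'D_u ('D_v f) y| < e & `|B - 'D_v ('D_u f) y| < e].
  by apply: filterS3 nA nB (open_near oU Ux) => y.
move=> /nbhs_ballP[r /= r0 rP].
have N : 0 <= `|u| + `|v| by exact: addr_ge0.
have [h h0 hr] : exists2 h : R, 0 < h & h * (`|u| + `|v|) < r.
  exists (r / (`|u| + `|v| + 1)); first by rewrite divr_gt0//; lra.
  by rewrite -mulrA gtr_pMr// mulrC ltr_pdivrMr ?mul1r; lra.
have inb (s t : R) w w' : `|w| + `|w'| = `|u| + `|v| -> 0 <= s <= 1 -> 0 <= t <= 1 ->
    ball x r (x + s *: (h *: w) + t *: (h *: w')).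
  move=> ww /andP[s0 s1] /andP[t0 t1]; rewrite -ball_normE/=.
  rewrite -addrA opprD addrA subrr add0r normrN.
  apply: le_lt_trans hr; rewrite -ww mulrDr; apply: le_trans (ler_normD _ _) _.
  rewrite !normrZ (ger0_norm s0) (ger0_norm t0) (gtr0_norm h0).
  by apply: lerD; rewrite ler_piMl// mulr_ge0// ltW.
have inU w w' s t : `|w| + `|w'| = `|u| + `|v| -> 0 <= s <= 1 -> 0 <= t <= 1 ->
    U (x + s *: (h *: w) + t *: (h *: w')).
  by move=> ww s01 t01; have [] := rP _ (inb _ _ _ _ ww s01 t01).
have [s [t [s01 t01 E1]]] := mixed_incrementE oU Ckf
  (fun s t s01 t01 => inU u v s t erefl s01 t01).
have [s' [t' [s01' t01' E2]]] := mixed_incrementE oU Ckf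
  (fun s t s01 t01 => inU v u s t (addrC _ _) s01 t01).
have [U1 _ P1] := rP _ (inb _ _ u v erefl s01 t01).
have [U2 P2 _] := rP _ (inb _ _ v u (addrC _ _) s01' t01').
rewrite (scale2 h _ _ _ U1) in E1; rewrite (scale2 h _ _ _ U2) mixed_incrementC E1 in E2.
move: E2 => /(scalerI (lt0r_neq0 h0))/(scalerI (lt0r_neq0 h0)) E.
rewrite -E in P2.
have := ler_normB (A - 'D_v ('D_u f) (x + s *: (h *: u) + t *: (h *: v)))
  (B - 'D_v ('D_u f) (x + s *: (h *: u) + t *: (h *: v))).
rewrite opprB addrA subrK => T.
have := lt_le_trans (ltrD P2 P1) (lexx _) => T2.
have := le_lt_trans T T2.
by rewrite /e -splitr ltxx.
Qed.

Lemma smooth_at_symmetric V W (f : V -> W) x u v : has_coords W ->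
  smooth_at f x -> 'D_u ('D_v f) x = 'D_v ('D_u f) x.
Proof.
move=> [m [e [l [cl le]]]] [U [oU Ux] sf].
apply: (coords_eq le) => i.
have Ckf := sf 2%N.
have Ll w w' : l i ('D_w' ('D_w f) x) = 'D_w' ('D_w (l i \o f)) x.
  have E : \forall y \near x, (l i \o 'D_w f) y = 'D_w (l i \o f) y.
    apply: filterS (open_near oU Ux) => y Uy.
    have /derivableP dy : derivable f y w by have [+ _] := Ckf.2 w; apply; rewrite inE.
    by have [_ ->] := is_derive_lin (cl i) dy.
  rewrite -(near_eq_derive _ E).
  have /derivableP dy : derivable ('D_w f) x w'.
    by have [_ [_ /(_ w') [+ _]]] := Ckf.2 w; apply; rewrite inE.
  by have [_ ->] := is_derive_lin (cl i) dy.
have S := derive_symmetric_real u v oU (Ck_on_lin (cl i) oU Ckf) Ux.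
exact: etrans (Ll v u) (etrans S (esym (Ll u v))).
Qed.

End Smooth.

(** * Coordinatewise calculus and uniqueness for linear differential inequalities *)

Section RowVectors.
Variables (R : realType) (n : nat).
Implicit Types (V : normedModType R).

Lemma normr_rV_le (x : 'rV[R]_n) (B : R) :
  0 <= B -> (forall j, `|x ord0 j| <= B) -> `|x| <= B.
Proof.
move=> B0 xB; rewrite [leLHS]/Num.Def.normr/= mx_normrE; apply: bigmax_le => // -[i j] _ /=.
by rewrite (ord1 i).
Qed.

Lemma coord_le_normr (x : 'rV[R]_n) j : `|x ord0 j| <= `|x|.
Proof.
rewrite [leRHS]/Num.Def.normr/= mx_normrE.
exact: (le_bigmax _ (fun ij : 'I_1 * 'I_n => `|x ij.1 ij.2|) (ord0, j)).
Qed.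

Lemma is_derive_rV V (f : V -> 'rV[R]_n) x v (d : 'rV[R]_n) :
  (forall j, is_derive x v (fun y => f y ord0 j : R^o) (d ord0 j)) <-> is_derive x v f d.
Proof.
split=> [H|[fv fd] j].
  have fv : derivable f x v.
    by apply/derivable_mxP => i j; rewrite (ord1 i); have [] := H j.
  split=> //; rewrite derive_mx//; apply/rowP => j; rewrite !mxE.
  by have [_ ->] := H j.
split; first by move/derivable_mxP : (fv); exact.
by rewrite -fd (derive_mx fv) mxE.
Qed.

Lemma continuous_rV (T : topologicalType) (f : T -> 'rV[R]_n) x :
  (forall j, {for x, continuous (fun y => f y ord0 j : R^o)}) -> {for x, continuous f}.
Proof.
move=> H; apply/cvgrPdist_le => e e0.
suff : \forall y \near x, forall j, `|f x ord0 j - f y ord0 j| <= e.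
  by apply: filterS => y yP; apply: normr_rV_le (ltW e0) _ => j; rewrite !mxE.
by apply: filter_forall => j; have /cvgrPdist_le/(_ e e0) := H j.
Qed.

(** The norm is the maximum of the coordinates, so the scalar mean value theorem on each coordinate
    loses no constant. *)
Lemma MVT_rV (z d : R -> 'rV[R]_n) (r B : R) : 0 <= B ->
  (forall t : R, `|t| < r -> is_derive t 1 z (d t)) ->
  (forall t : R, `|t| < r -> `|d t| <= B) ->
  forall t, `|t| < r -> `|z t - z 0| <= B * `|t|.
Proof.
move=> B0 dz dB t tr; apply: normr_rV_le => [|j]; first exact: mulr_ge0.
rewrite !mxE; pose w (s : R) : R := z s ord0 j.
have dw (s : R) : `|s| < r -> is_derive s 1 w (d s ord0 j) by move=> /dz/is_derive_rV/(_ j).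
have bound (s : R) : `|s| <= `|t| -> `|d s ord0 j| <= B.
  move=> st; apply: le_trans (coord_le_normr _ _) (dB _ _).
  exact: le_lt_trans st tr.
have wc (a b : R) : (forall s, a <= s <= b -> `|s| <= `|t|) -> {within `[a, b], continuous w}.
  move=> H; apply: derivable_within_continuous => s /[!in_itv] /= /H st.
  by have [] := dw _ (le_lt_trans st tr).
have [t0|/ltW t0] := leP 0 t.
  have st (s : R) : 0 <= s <= t -> `|s| <= `|t|.
    by move=> /andP[s0 ?]; rewrite !ger0_norm.
  have [|s sI ->] := @MVT_segment R w (fun s => d s ord0 j) 0 t t0 _ (wc _ _ st).
    move=> s /[!in_itv]/= /andP[s0 s1]; apply: dw; apply: le_lt_trans tr.
    by apply: st; rewrite !ltW.
  rewrite subr0 normrM ler_wpM2r//; apply/bound/st.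
  by move: sI; rewrite in_itv.
have st (s : R) : t <= s <= 0 -> `|s| <= `|t|.
  by move=> /andP[? s0]; rewrite !ler0_norm// lerN2.
have [|s sI] := @MVT_segment R w (fun s => d s ord0 j) t 0 t0 _ (wc _ _ st).
  move=> s /[!in_itv]/= /andP[s0 s1]; apply: dw; apply: le_lt_trans tr.
  by apply: st; rewrite !ltW.
rewrite -/(w t) -/(w 0) distrC => ->.
rewrite sub0r normrM normrN ler_wpM2r//; apply/bound/st.
by move: sI; rewrite in_itv.
Qed.

Lemma half_pow_le0 (C x : R) : (forall k, x <= C * (1 / 2) ^+ k) -> x <= 0.
Proof.
move=> xC; have H : geometric C (1 / 2) @ \oo --> (0 : R).
  by apply: cvg_geometric; rewrite ger0_norm; lra.
by apply: (cvgr_to_ge H); exact: nearW.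
Qed.

(** A replacement for Gronwall's inequality. Continuity at 0 first bounds d by 1. For t below 1 / (2
    (L + 1)) the mean value inequality then turns any bound on d into half of it, so d is below
    every power of 1 / 2. *)
Lemma linear_growth_zero (d d' : R -> 'rV[R]_n) (r L : R) : 0 < r -> 0 <= L ->
  (forall t : R, `|t| < r -> is_derive t 1 d (d' t)) ->
  (forall t : R, `|t| < r -> `|d' t| <= L * `|d t|) -> d 0 = 0 ->
  exists2 r', 0 < r' & forall t, `|t| < r' -> d t = 0.
Proof.
move=> r0 L0 dd d'L d0.
have cd : {for 0, continuous d}.
  have [|+ _] := dd 0; first by rewrite normr0.
  by move=> /derivable1_diffP/differentiable_continuous.
have : \forall t \near (0 : R), `|d 0 - d t| < 1.
  by have /cvgrPdist_lt/(_ _ ltr01) := cd.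
rewrite d0 => /nbhs_ballP[r1 /= r10 r1P].
pose r' := Num.min r (Num.min r1 (1 / (2 * (L + 1)))).
have L1 : 0 < 2 * (L + 1) by lra.
have r'0 : 0 < r' by rewrite !lt_min r0 r10 divr_gt0.
exists r' => //.
have d_small k (t : R) : `|t| < r' -> `|d t| <= (1 / 2) ^+ k.
  elim: k t => [|k IH] t tr'.
    rewrite expr0; have [_ tr1] : `|t| < r /\ `|t| < r1.
      by move: tr'; rewrite !lt_min => /and3P[].
    have /r1P : ball 0 r1 t by rewrite -ball_normE/= sub0r normrN.
    by rewrite sub0r normrN => /ltW.
  have B0 : 0 <= L * (1 / 2) ^+ k by rewrite mulr_ge0// exprn_ge0//; lra.
  have lr (s : R) : `|s| < r' -> `|s| < r by rewrite lt_min => /andP[].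
  have := @MVT_rV d d' r' _ B0 (fun s sr => dd s (lr s sr)) _ t tr'.
  rewrite d0 subr0 => H; apply: le_trans (H _) _.
    by move=> s sr; apply: le_trans (d'L _ (lr _ sr)) _; rewrite ler_wpM2l// IH.
  rewrite exprS mulrAC; apply: ler_wpM2r; first by rewrite exprn_ge0//; lra.
  have [_ _] : [/\ `|t| < r, `|t| < r1 & `|t| < 1 / (2 * (L + 1))].
    by move: tr'; rewrite !lt_min => /and3P[].
  rewrite ltr_pdivlMr// => H2; have := normr_ge0 t; lra.
move=> t tr'; apply/eqP; rewrite -normr_eq0 eq_le normr_ge0 andbT.
apply: (@half_pow_le0 1) => k; rewrite mul1r; exact: d_small.
Qed.

End RowVectors.

(** * Local solutions of ordinary differential equations *)

Section Clamp.
Variable R : realType.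
Implicit Types r s t : R.

(* The truncation of t to [-r, r]. *)
Definition clamp r t : R := (`|t + r| - `|t - r|) / 2.

Lemma clamp_id r t : `|t| <= r -> clamp r t = t.
Proof.
rewrite ler_norml => /andP[t1 t2]; rewrite /clamp ger0_norm; last by lra.
by rewrite ler0_norm; lra.
Qed.

Lemma clamp_le r t : 0 <= r -> `|clamp r t| <= r.
Proof.
move=> r0; rewrite /clamp ler_norml.
by case: (ler0P (t + r)) => ?; case: (ler0P (t - r)) => ?; apply/andP; split; lra.
Qed.

Lemma clamp_lipschitz r s t : `|clamp r s - clamp r t| <= `|s - t|.
Proof.
rewrite /clamp.
have A : `| `|s + r| - `|t + r| | <= `|s - t|.
  by apply: le_trans (ler_dist_dist _ _) _; have -> : s + r - (t + r) = s - t by ring.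
have B : `| `|s - r| - `|t - r| | <= `|s - t|.
  by apply: le_trans (ler_dist_dist _ _) _; have -> : s - r - (t - r) = s - t by ring.
move: A B; rewrite !ler_norml => /andP[? ?] /andP[? ?].
by apply/andP; split; lra.
Qed.

Lemma clamp_continuous r : continuous (clamp r).
Proof.
move=> t; apply/cvgrPdist_le => e e0; near=> s.
apply: le_trans (clamp_lipschitz _ _ _) _.
by near: s; apply: cvgr_dist_le.
Unshelve. all: by end_near. Qed.

End Clamp.

Section Picard.
Variables (R : realType) (n : nat).
Local Notation E := 'rV[R]_n.

Lemma continuous_primitive (f : R -> R) (r : R) : 0 < r -> continuous f ->
  exists F : R -> R, [/\ F 0 = 0, continuous F &
    forall t : R, `|t| < r -> is_derive t 1 F (f t)].
Proof.
(* The integral is differentiable for t below [r2] in absolute value. Truncating its argument at the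
   intermediate [r1] makes the primitive continuous on the whole line without changing it near any t
   below r. *)
move=> r0 cf; pose r1 := r + 1; pose r2 := r + 2.
pose I (x : R) : R := (\int[lebesgue_measure]_(t in [set` `[- r2, x]]) f t)%R.
have dI (t : R) : `|t| < r2 -> is_derive t 1 I (f t).
  rewrite ltr_norml => /andP[t1 t2].
  have [|dI IE] := @continuous_FTC1_closed R f (- r2) t r2 t2 _ t1 (cf t).
    apply: continuous_compact_integrable; first exact: segment_compact.
    exact: continuous_subspaceT.
  by split; [exact: dI|rewrite -derive1E].
exists (fun t => I (clamp r1 t) - I 0); split.
- by rewrite clamp_id ?subrr// normr0 /r1; lra.
- move=> t; apply: cvgB; last exact: cvg_cst.
  apply: (@continuous_comp _ _ _ (clamp r1) I); first exact: clamp_continuous.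
  have [|+ _] := dI (clamp r1 t).
    by apply: le_lt_trans (clamp_le _ _) _; rewrite /r1 /r2; lra.
  by move=> /derivable1_diffP/differentiable_continuous.
- move=> t tr; have dt : is_derive t 1 I (f t) by apply: dI; rewrite /r2; lra.
  have dB : is_derive t 1 (I - cst (I 0)) (f t - 0).
    by apply: is_deriveB; exact: is_derive_cst.
  rewrite subr0 in dB; apply: near_eq_is_derive dB; near=> s.
  rewrite clamp_id//.
  suff : `|s| < r1 by move/ltW.
  by near: s; apply: cvgr_norm_lt; [exact: cvg_id|rewrite /r1; lra].
Unshelve. all: by end_near. Qed.

Lemma continuous_primitive_rV (f : R -> E) (r : R) : 0 < r -> continuous f ->
  exists F : R -> E, [/\ F 0 = 0, continuous F &
    forall t : R, `|t| < r -> is_derive t 1 F (f t)].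
Proof.
move=> r0 cf.
have /choice[F FP] : forall j : 'I_n, exists F : R -> R, [/\ F 0 = 0, continuous F &
    forall t : R, `|t| < r -> is_derive t 1 F (f t ord0 j)].
  move=> j; apply: continuous_primitive => // t.
  by apply: (@continuous_comp _ _ _ f (fun x : E => x ord0 j)); [exact: cf|exact: coord_continuous].
have rowE j : (fun t => (\row_j F j t) ord0 j) = F j by apply/funext => t; rewrite mxE.
exists (fun t => \row_j F j t); split.
- by apply/rowP => j; rewrite !mxE; have [] := FP j.
- move=> t; apply: continuous_rV => j; have [_ cF _] := FP j.
  by rewrite -rowE in cF; exact: cF.
- move=> t tr; apply/is_derive_rV => j; have [_ _ dF] := FP j.
  by rewrite rowE; exact: dF.
Qed.

Lemma half_pow_cauchy (u : nat -> E) (M : R) : 0 <= M ->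
  (forall k, `|u k.+1 - u k| <= M * (1 / 2) ^+ k) ->
  exists l, forall k, `|l - u k| <= 2 * M * (1 / 2) ^+ k.
Proof.
move=> M0 uM.
(* The factor 1 - (1 / 2)^i makes this the exact partial sum of the geometric series, which is what
   lets the induction close. *)
have tail k i : `|u (k + i)%N - u k| <= 2 * M * (1 / 2) ^+ k * (1 - (1 / 2) ^+ i).
  elim: i => [|i IH]; first by rewrite addn0 subrr normr0 expr0 subrr mulr0.
  rewrite addnS -(subrKA (u (k + i)%N)); apply: le_trans (ler_normD _ _) _.
  apply: le_trans (lerD (uM _) IH) _.
  rewrite exprD exprS; set a := (1 / 2) ^+ k; set b := (1 / 2) ^+ i.
  by rewrite le_eqVlt; apply/orP; left; apply/eqP; field.
have half_ge0 k : 0 <= (1 / 2) ^+ k :> R by rewrite exprn_ge0//; lra.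
have tail' k i : `|u (k + i)%N - u k| <= 2 * M * (1 / 2) ^+ k.
  apply: le_trans (tail _ _) _; rewrite ler_piMr//.
  by rewrite mulr_ge0// mulr_ge0.
have cu : cvgn u.
  apply: cauchy_cvg; apply/cauchy_ballP => e e0.
  have H : geometric (2 * M) (1 / 2) @ \oo --> (0 : R).
    by apply: cvg_geometric; rewrite ger0_norm; lra.
  have e2 : 0 < e / 2 by rewrite divr_gt0.
  have [N _ NP] : \forall k \near \oo, `|0 - geometric (2 * M) (1 / 2) k| < e / 2.
    by have /cvgrPdist_lt/(_ _ e2) := H.
  have {}NP : 2 * M * (1 / 2) ^+ N < e / 2.
    have := NP N (leqnn N); rewrite sub0r normrN ger0_norm//=.
    by rewrite mulr_ge0// mulr_ge0.
  have tN : \forall k \near \oo, `|u k - u N| < e / 2.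
    exists N => // k /= Nk; rewrite -(subnKC Nk).
    exact: le_lt_trans (tail' _ _) NP.
  pose A := [set x : E | `|x - u N| < e / 2].
  exists (A, A); first by split.
  move=> [x y] [/= xA yA]; rewrite -ball_normE /=.
  rewrite -(subrKA (u N)); apply: le_lt_trans (ler_normD _ _) _.
  by rewrite [e]splitr; apply: ltrD => //; rewrite distrC.
exists (lim (u @ \oo)) => k.
have H : `|u i - u k| @[i --> \oo] --> `|lim (u @ \oo) - u k|.
  by apply: cvg_norm; apply: cvgB => //; exact: cvg_cst.
apply: (cvgr_to_le H); exists k => // i /= ki.
by rewrite -(subnKC ki).
Qed.

(* The Picard iterates contract on |t| < r; their limit is only used on |t| <= r / 2,
   where composing with [clamp] makes it continuous on the whole line. *)
Lemma picard_global (Y : E -> E) (L r : R) (p : E) : 0 < r -> 0 <= L -> L * r <= 1 / 2 ->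
  (forall u v, `|Y u - Y v| <= L * `|u - v|) ->
  exists y : R -> E, y 0 = p /\ forall t : R, `|t| < r / 2 -> is_derive t 1 y (Y (y t)).
Proof.
move=> r0 L0 Lr LY.
have cY : continuous Y.
  move=> u; apply/(@cvgrPdist_lt _ _ _ (nbhs u) (nbhs_filter u) Y) => e e0.
  have e1 : 0 < e / (L + 1) by rewrite divr_gt0//; lra.
  apply/nbhs_ballP; exists (e / (L + 1)) => //= v; rewrite -ball_normE /= => uv.
  apply: le_lt_trans (LY _ _) _.
  apply: (@le_lt_trans _ _ ((L + 1) * `|u - v|)); first by rewrite ler_wpM2r//; lra.
  by rewrite mulrC -ltr_pdivlMr//; lra.
(* [Phi] is the Picard operator y -> p + integral of Y(y), made total by sending a discontinuous y
   to itself. *)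
have /choice[Phi PhiP] : forall y : R -> E, exists z : R -> E, continuous y ->
    [/\ z 0 = p, continuous z & forall t : R, `|t| < r -> is_derive t 1 z (Y (y t))].
  move=> y; have [cy|ncy] := pselect (continuous y); last by exists y.
  have [|F [F0 cF dF]] := @continuous_primitive_rV (Y \o y) r r0.
    by move=> t; apply: continuous_comp; [exact: cy|exact: cY].
  exists (fun t => p + F t) => _; split; first by rewrite F0 addr0.
    by move=> t; apply: cvgD; [exact: cvg_cst|exact: cF].
  move=> t /dF dFt; rewrite -[Y _]add0r.
  by apply: (@is_deriveD _ _ _ (cst p)); exact: is_derive_cst.
(* The factor 1 / 2 is the assumption on L * r. The radius q is left free: it is r for the iterates
   and r / 2 for the truncated limit, which agrees with the limit only there. *)
have Phi_contraction y z (B q : R) : 0 <= B -> q <= r -> continuous y -> continuous z ->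
    (forall t : R, `|t| < q -> `|y t - z t| <= B) ->
    forall t : R, `|t| < q -> `|Phi y t - Phi z t| <= B / 2.
  move=> B0 qr /PhiP[y0 cy dy] /PhiP[z0 cz dz] yzB t tq.
  have lt_r (s : R) : `|s| < q -> `|s| < r by move=> /lt_le_trans; apply.
  have H := @MVT_rV R n (fun t => Phi y t - Phi z t) (fun t => Y (y t) - Y (z t))
    q (L * B) (mulr_ge0 L0 B0) (fun s sq => is_deriveB (dy s (lt_r s sq)) (dz s (lt_r s sq))).
  have := H (fun s sr => le_trans (LY _ _) (ler_wpM2l L0 (yzB s sr))) t tq.
  rewrite y0 z0 subrr subr0 => /le_trans; apply.
  apply: (@le_trans _ _ (L * B * r)); first by rewrite ler_wpM2l ?mulr_ge0// ltW// lt_r.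
  by rewrite mulrAC [leRHS]mulrC ler_wpM2r//; lra.
pose y_ k := iter k Phi (cst p).
have cy k : continuous (y_ k).
  by elim: k => [t|k /PhiP[]//]; exact: cvg_cst.
have y_M k (t : R) : `|t| < r -> `|y_ k.+1 t - y_ k t| <= `|Y p| * r * (1 / 2) ^+ k.
  elim: k t => [|k IH] t tr.
    have [y0 _ dy] := PhiP _ (cy 0%N).
    have := MVT_rV (normr_ge0 (Y p)) dy (fun s _ => lexx _) tr.
    rewrite y0 expr0 mulr1 => /le_trans; apply.
    by rewrite ler_wpM2l// ltW.
  have -> : `|Y p| * r * (1 / 2) ^+ k.+1 = `|Y p| * r * (1 / 2) ^+ k / 2.
    by rewrite exprS; field.
  apply: (Phi_contraction _ _ _ r) => //; last exact: (cy k.+1).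
  by rewrite !mulr_ge0// ?exprn_ge0//; lra.
have /choice[y yP] : forall t : R, exists l, `|t| < r ->
    forall k, `|l - y_ k t| <= 2 * (`|Y p| * r) * (1 / 2) ^+ k.
  move=> t; have [tr|] := ltP `|t| r; last by exists 0.
  have [||l lP] := @half_pow_cauchy (y_ ^~ t) (`|Y p| * r).
  - by rewrite mulr_ge0// ltW.
  - by move=> k; exact: y_M.
  by exists l.
have cy' : continuous (y \o clamp (r / 2)).
  have r2 : r / 2 < r by lra.
  have yP' k t : `|y (clamp (r / 2) t) - y_ k (clamp (r / 2) t)| <=
      2 * (`|Y p| * r) * (1 / 2) ^+ k.
    by apply: yP; apply: le_lt_trans r2; apply: clamp_le; lra.
  move=> t; apply/cvgrPdist_lt => e e0.
  have H : geometric (2 * (`|Y p| * r)) (1 / 2) @ \oo --> (0 : R).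
    by apply: cvg_geometric; rewrite ger0_norm; lra.
  have e4 : 0 < e / 4 by rewrite divr_gt0.
  have [k _ kP] : \forall k \near \oo, `|0 - geometric (2 * (`|Y p| * r)) (1 / 2) k| < e / 4.
    by have /cvgrPdist_lt/(_ _ e4) := H.
  have {}kP : 2 * (`|Y p| * r) * (1 / 2) ^+ k < e / 4.
    have := kP k (leqnn k); rewrite sub0r normrN => /(le_lt_trans (ler_norm _)).
    exact.
  have ck : {for t, continuous (y_ k \o clamp (r / 2))}.
    by apply: continuous_comp; [exact: clamp_continuous|exact: cy].
  near=> s.
  have A : `|y_ k (clamp (r / 2) t) - y_ k (clamp (r / 2) s)| < e / 4.
    near: s; have /cvgrPdist_lt/(_ _ e4) := ck; exact: id.
  have := yP' k t; have := yP' k s; rewrite distrC /= => B C.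
  rewrite -(subrKA (y_ k (clamp (r / 2) t))); apply: le_lt_trans (ler_normD _ _) _.
  rewrite -(subrKA (y_ k (clamp (r / 2) s)) (y_ k (clamp (r / 2) t))).
  have := ler_normD (y_ k (clamp (r / 2) t) - y_ k (clamp (r / 2) s))
    (y_ k (clamp (r / 2) s) - y (clamp (r / 2) s)).
  by move=> D; lra.
have [z0 cz dz] := PhiP _ cy'.
(* The limit is a fixed point: both sides are within a multiple of (1 / 2)^k of the iterate
   [y_ k.+1], for every k. *)
have zy (t : R) : `|t| < r / 2 -> Phi (y \o clamp (r / 2)) t = y t.
  move=> tr; apply/eqP; rewrite -subr_eq0 -normr_eq0 eq_le normr_ge0 andbT.
  apply: (@half_pow_le0 R (2 * (2 * (`|Y p| * r)))) => k.
  have tr' : `|t| < r by lra.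
  have B0 : 0 <= 2 * (`|Y p| * r) * (1 / 2) ^+ k.
    by rewrite mulr_ge0 ?exprn_ge0// ?mulr_ge0// ?ltW//; lra.
  have r2 : r / 2 <= r by lra.
  have := Phi_contraction (y \o clamp (r / 2)) (y_ k) _ _ B0 r2 cy' (cy k) _ _ tr.
  rewrite -[Phi (y_ k)]/(y_ k.+1) => /(_ _)/wrap[].
    move=> s sr; have sr' : `|s| < r by lra.
    by have := yP s sr' k; rewrite /= clamp_id ?(ltW sr).
  move=> A; have := yP _ tr' k.+1; rewrite exprS distrC => B.
  rewrite -(subrKA (y_ k.+1 t)); apply: le_trans (ler_normD _ _) _.
  have : 0 <= (1 / 2 : R) ^+ k by rewrite exprn_ge0//; lra.
  move: A B B0; set c := (1 / 2) ^+ k; set D := `|Y p| * r => A B B0 c0.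
  have -> : 2 * (2 * D) * c = 2 * (2 * D * c) by ring.
  have E : 2 * D * (1 / 2 * c) = 2 * D * c / 2 by ring.
  by rewrite E in B; lra.
exists (Phi (y \o clamp (r / 2))); split=> // t tr.
have [|dt dE] := dz t; first by lra.
by split=> //; rewrite dE /= clamp_id ?ltW// zy.
Unshelve. all: by end_near. Qed.

End Picard.

(** The finitely many derivatives along the basis are continuous, so near p each exceeds its size at
    p by at most 1; the coordinates of w are bounded by its norm. The bound gives both the Lipschitz
    constant for the existence theorem and the growth constant of the linear equation. *)
Lemma derive_bounded (R : realType) (V W : normedModType R) (Y : V -> W) (p : V) :
  has_coords V -> has_coords W -> smooth_at Y p ->
  exists2 L : R, 0 <= L & \forall z \near p, forall w, `|'D_w Y z| <= L * `|w|.
Proof.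
move=> cV cW sY; case: (cV) => m [e [l [cl le]]].
have sD i : smooth_at ('D_(e i) Y) p by exact: smooth_at_derive.
have /choice[C CP] i : exists C : R, 0 < C /\ forall v, `|l i v| <= C * `|v|.
  by have [c] := linear_lipschitz (cl i); exists c.
pose K := \sum_i C i * (`|'D_(e i) Y p| + 1).
have K0 : 0 <= K by apply: sumr_ge0 => i _; rewrite mulr_ge0 ?addr_ge0// ltW//; case: (CP i).
exists K => //.
have N : \forall z \near p, forall i, `|'D_(e i) Y z| <= `|'D_(e i) Y p| + 1.
  apply: filter_forall => i.
  have /cvgrPdist_lt/(_ _ ltr01) := smooth_at_continuous (sD i).
  apply: filterS => z zP; rewrite -lerBlDl; apply: le_trans (lerB_dist _ _) _.
  by rewrite distrC ltW.
apply: filterS2 (smooth_at_near sY) N => z sz zP w.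
have -> : 'D_w Y z = \sum_i l i w *: 'D_(e i) Y z.
  have D : differentiable Y z by exact: smooth_at_differentiable.
  by have := derive_coords (fun i => l i w) e D; rewrite -le.
apply: le_trans (ler_norm_sum _ _ _) _; rewrite mulr_suml; apply: ler_sum => i _.
rewrite normrZ mulrAC; apply: ler_pM => //; exact: (CP i).2.
Qed.

Section LocalFlow.
Variables (R : realType) (n : nat).
Local Notation E := 'rV[R]_n.

Lemma locally_lipschitz (Y : E -> E) (p : E) : smooth_at Y p ->
  exists L r : R, [/\ 0 <= L, 0 < r &
    forall u v, `|u - p| <= r -> `|v - p| <= r -> `|Y u - Y v| <= L * `|u - v|].
Proof.
move=> sY; have [L L0 LP] := derive_bounded (has_coords_rV R n) (has_coords_rV R n) sY.
have : \forall z \near p, smooth_at Y z /\ forall w, `|'D_w Y z| <= L * `|w|.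
  by apply: filterS2 (smooth_at_near sY) LP.
(* Halving the radius puts closed balls, with the segments between their points, inside the open
   ball where the bound holds. *)
move=> /nbhs_ballP[r /= r0 rP]; exists L, (r / 2); split=> // [|u v up vp].
  by rewrite divr_gt0.
have seg (s : R) : 0 <= s <= 1 -> ball p r (v + s *: (u - v)).
  move=> /andP[s0 s1]; rewrite -ball_normE /= distrC.
  have -> : v + s *: (u - v) - p = (1 - s) *: (v - p) + s *: (u - p).
    by rewrite !scalerBl !scalerBr scale1r; apply/rowP => i; rewrite !mxE; ring.
  apply: le_lt_trans (ler_normD _ _) _; rewrite !normrZ ger0_norm ?subr_ge0//.
  rewrite (ger0_norm s0); have : (1 - s) * `|v - p| <= (1 - s) * (r / 2).
    by rewrite ler_wpM2l// subr_ge0.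
  have : s * `|u - p| <= s * (r / 2) by rewrite ler_wpM2l.
  by lra.
apply: normr_rV_le => [|j]; first by rewrite mulr_ge0.
pose Yj (z : E) : R^o := Y z ord0 j.
have dY z : ball p r z -> is_derive z (u - v) Yj ('D_(u - v) Y z ord0 j).
  move=> /rP[sz _].
  by have /derivableP/is_derive_rV/(_ j) := smooth_at_derivable sz (v := u - v).
have [s s01 sE] := @MVT_line R E Yj v (u - v)
  (fun s s01 => let: DeriveDef q _ := dY _ (seg s s01) in q).
have [_ dE] := dY _ (seg s s01).
rewrite subrKC dE /Yj in sE; rewrite !mxE sE.
apply: le_trans (coord_le_normr _ _) _.
by have [_] := rP _ (seg s s01); exact.
Qed.

(** Truncating every coordinate gives a retraction c onto a closed box around p that does not
    increase distances, so Y composed with c is globally Lipschitz. Its solution starts at p and by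
    continuity stays in the box for a short time, where c is the identity. *)
Lemma ode_local (Y : E -> E) (p : E) : smooth_at Y p ->
  exists (y : R -> E) (eps : R), [/\ 0 < eps, y 0 = p &
    forall t : R, `|t| < eps -> is_derive t 1 y (Y (y t))].
Proof.
move=> /locally_lipschitz[L [r [L0 r0 LP]]].
pose c (u : E) : E := \row_j (p ord0 j + clamp r (u ord0 j - p ord0 j)).
have cP u : `|c u - p| <= r.
  apply: normr_rV_le => [|j]; first exact: ltW.
  by rewrite !mxE addrC addKr clamp_le// ltW.
have c_lip u v : `|c u - c v| <= `|u - v|.
  apply: normr_rV_le => // j; rewrite !mxE opprD addrACA subrr add0r.
  apply: le_trans (clamp_lipschitz _ _ _) _.
  have -> : u ord0 j - p ord0 j - (v ord0 j - p ord0 j) = (u - v) ord0 j.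
    by rewrite !mxE; ring.
  exact: coord_le_normr.
have c_id u : `|u - p| <= r -> c u = u.
  move=> ur; apply/rowP => j; rewrite mxE clamp_id ?subrKC//.
  have := coord_le_normr (u - p) j; rewrite !mxE => /le_trans; exact.
have L1 : 0 < 2 * (L + 1) by lra.
(* Chosen so that L * a is at most 1 / 2; the summand 1 allows L = 0. *)
pose a := 1 / (2 * (L + 1)).
have a0 : 0 < a by rewrite divr_gt0.
have La : L * a <= 1 / 2.
  by rewrite mulrA ler_pdivrMr//; lra.
have [|y [y0 dy]] := @picard_global R n (Y \o c) L a p a0 L0 La.
  move=> u v; apply: le_trans (LP _ _ (cP u) (cP v)) _.
  by rewrite ler_wpM2l.
have cy : {for 0, continuous y}.
  have [|+ _] := dy 0; first by rewrite normr0; lra.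
  by move=> /derivable1_diffP/differentiable_continuous.
have : \forall t \near (0 : R), `|y 0 - y t| < r by have /cvgrPdist_lt/(_ _ r0) := cy.
move=> /nbhs_ballP[r1 /= r10 r1P].
exists y, (Num.min (a / 2) r1); split=> //.
  by rewrite lt_min r10 andbT; lra.
move=> t; rewrite lt_min => /andP[ta tr1].
have := dy t ta; rewrite /= c_id//.
have : ball 0 r1 t by rewrite -ball_normE /= sub0r normrN.
by move=> /r1P; rewrite y0 distrC => /ltW.
Qed.

End LocalFlow.

(** * Charts and translations *)

Section Charts.
Variables (R : realType) (n : nat) (M : topologicalType) (c : chart R n M).

Lemma cimg_cmap x : cdom c x -> cimg c (cmap c x).
Proof. by exists x. Qed.

Lemma cinvK z : cimg c z -> cmap c (cinv c z) = z.
Proof. by move=> [x cx <-]; rewrite cmapK// inE. Qed.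

Lemma cdom_cinv z : cimg c z -> cdom c (cinv c z).
Proof. by move=> [x cx <-]; rewrite cmapK// inE. Qed.

Lemma cmap_cinv x : cdom c x -> cinv c (cmap c x) = x.
Proof. by move=> cx; rewrite cmapK// inE. Qed.

Lemma cimg_near z : cimg c z -> \forall w \near z, cimg c w.
Proof. by move=> cz; apply: open_nbhs_nbhs; split=> //; exact: cimg_open. Qed.

Lemma cdom_near x : cdom c x -> \forall y \near x, cdom c y.
Proof. by move=> cx; apply: open_nbhs_nbhs; split=> //; exact: cdom_open. Qed.

Lemma cinv_continuous_at z : cimg c z -> {for z, continuous (cinv c)}.
Proof. by move=> cz; apply: cinv_continuous; rewrite inE. Qed.

Lemma cmap_continuous_at x : cdom c x -> {for x, continuous (cmap c)}.
Proof. by move=> cx; apply: cmap_continuous; rewrite inE. Qed.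

Lemma cinv_near z (P : M -> Prop) : cimg c z -> (\forall x \near cinv c z, P x) ->
  \forall w \near z, P (cinv c w).
Proof. by move=> cz; apply: cinv_continuous_at. Qed.

Lemma cmap_near x (P : 'rV[R]_n -> Prop) : cdom c x -> (\forall z \near cmap c x, P z) ->
  \forall y \near x, P (cmap c y).
Proof. by move=> cx; apply: cmap_continuous_at. Qed.

End Charts.

Lemma open_norm_lt (R : realType) (V : normedModType R) (r : R) :
  open [set x : V | `|x| < r].
Proof.
have -> : [set x : V | `|x| < r] = ball_ Num.norm 0 r.
  by apply/funext => x; rewrite /ball_ /= sub0r normrN.
by rewrite ball_normE; exact: ball_open.
Qed.

(** The sets in the Lie group axioms are not given as open; it suffices that they are neighbourhoods
    of the point considered. *)
Lemma smooth_on_near (R : realType) (V W : normedModType R) (S : set V) (f : V -> W) x :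
  smooth_on S f -> (\forall y \near x, S y) -> smooth_at f x.
Proof.
move=> sf /near_open[U [oU Ux US]]; exists U => // k.
exact: Ck_on_sub (sf k).
Qed.

Section GroupSmoothness.
Variables (R : realType) (n : nat) (G : lieGroupType R n).
Local Notation E := 'rV[R]_n.
Local Notation atlas := (@atlas R n G).
Implicit Types (c d e : chart R n G) (f : G -> R^o).

Let hE := has_coords_rV R n.
Let hR := has_coords_R R.

Lemma mulgl_continuous (g : G) : continuous (fun x : G => (g * x)%g).
Proof.
move=> x; have C : (g, y) @[y --> x] --> (g, x).
  by apply: cvg_pair; [exact: cvg_cst|exact: cvg_id].
exact: cvg_comp C (@mulg_continuous R n G (g, x)).
Qed.

Lemma mulgr_continuous (g : G) : continuous (fun x : G => (x * g)%g).
Proof.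
move=> x; have C : (y, g) @[y --> x] --> (x, g).
  by apply: cvg_pair; [exact: cvg_id|exact: cvg_cst].
exact: cvg_comp C (@mulg_continuous R n G (x, g)).
Qed.

Lemma chart_change_smooth c d x : atlas c -> atlas d -> cdom c x -> cdom d x ->
  smooth_at (cmap d \o cinv c) (cmap c x).
Proof.
move=> ac ad cx dx; apply: smooth_on_near (atlas_smooth c d ac ad) _.
have H : \forall w \near cmap c x, cdom d (cinv c w).
  apply: cinv_near; first exact: cimg_cmap.
  by rewrite cmap_cinv//; exact: cdom_near.
apply: filterS2 (cimg_near (cimg_cmap cx)) H => w cw dw.
exists (cinv c w); last exact: cinvK.
by split=> //; exact: cdom_cinv.
Qed.

Lemma mul_smooth c d e x y : atlas c -> atlas d -> atlas e ->
  cdom c x -> cdom d y -> cdom e (x * y)%g ->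
  smooth_at (fun z : E * E => cmap e (cinv c z.1 * cinv d z.2)%g) (cmap c x, cmap d y).
Proof.
move=> ac ad ae cx dy exy; apply: smooth_on_near (mulg_smooth c d e ac ad ae) _.
have H : \forall z \near (cmap c x, cmap d y), cdom e (cinv c z.1 * cinv d z.2)%g.
  have C : (cinv c z.1, cinv d z.2) @[z --> (cmap c x, cmap d y)] --> (x, y).
    apply: cvg_pair.
      rewrite -[in X in _ --> X](cmap_cinv cx).
      by apply: cvg_comp; [exact: cvg_fst|exact/(@cinv_continuous_at _ _ _ c)/cimg_cmap].
    rewrite -[in X in _ --> X](cmap_cinv dy).
    by apply: cvg_comp; [exact: cvg_snd|exact/(@cinv_continuous_at _ _ _ d)/cimg_cmap].
  have C' : (cinv c z.1 * cinv d z.2)%g @[z --> (cmap c x, cmap d y)] --> (x * y)%g.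
    exact: cvg_comp C (@mulg_continuous R n G (x, y)).
  exact: C' _ (cdom_near exy).
have H1 : \forall z \near (cmap c x, cmap d y), cimg c z.1.
  by apply: (cvg_fst (G := nbhs (cmap d y))); exact/cimg_near/cimg_cmap.
have H2 : \forall z \near (cmap c x, cmap d y), cimg d z.2.
  by apply: (cvg_snd (F := nbhs (cmap c x))); exact/cimg_near/cimg_cmap.
by apply: filterS3 H H1 H2 => z; split.
Qed.

(** One chart is enough to test smoothness, since chart changes carry it to all others
    ([gsmooth_at_chart]). *)
Definition gsmooth_at f x :=
  exists c, [/\ atlas c, cdom c x & smooth_at (f \o cinv c : E -> R^o) (cmap c x)].

Lemma gsmooth_at_chart f x c : gsmooth_at f x -> atlas c -> cdom c x ->
  smooth_at (f \o cinv c : E -> R^o) (cmap c x).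
Proof.
move=> [d [ad dx sf]] ac cx.
have s : smooth_at ((f \o cinv d : E -> R^o) \o (cmap d \o cinv c)) (cmap c x).
  apply: smooth_at_comp => //; first exact: chart_change_smooth.
  by rewrite /= cmap_cinv.
apply: smooth_at_eq s.
have : \forall w \near cmap c x, cdom d (cinv c w).
  apply: cinv_near; first exact: cimg_cmap.
  by rewrite cmap_cinv//; exact: cdom_near.
by apply: filterS => w dw /=; rewrite cmap_cinv.
Qed.

Lemma gsmooth_at_near f x : gsmooth_at f x -> \forall y \near x, gsmooth_at f y.
Proof.
move=> [c [ac cx sf]].
have := cmap_near cx (smooth_at_near sf).
by apply: filterS2 (cdom_near cx) => y cy sy; exists c.
Qed.

Lemma smooth_near1E f : smooth_near1 f <-> gsmooth_at f 1%g.
Proof.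
split=> [[U [oU U1 sf]]|sf].
  have [c ac c1] := atlas_cover (1%g : G); exists c; split=> //.
  apply: smooth_on_near (sf c ac) _.
  have H : \forall w \near cmap c 1%g, U (cinv c w).
    apply: cinv_near; first exact: cimg_cmap.
    by rewrite cmap_cinv//; exact: open_nbhs_nbhs.
  apply: filterS2 (cimg_near (cimg_cmap c1)) H => w cw dw.
  exists (cinv c w); last exact: cinvK.
  by split=> //; exact: cdom_cinv.
have : nbhs (1%g : G) [set y | gsmooth_at f y] by exact: gsmooth_at_near.
rewrite nbhsE => -[U [oU U1] UP].
exists U; split=> // c ac; apply: smooth_at_on => _ [x [Ux cx] <-].
by apply: gsmooth_at_chart => //; exact: UP.
Qed.

(** Three charts are involved, around g, x and g x: translation is the smooth group law with its
    first coordinate frozen, followed by f read in the third chart. *)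
Lemma gsmooth_at_mulgl f g x : gsmooth_at f (g * x)%g ->
  gsmooth_at (fun y => f (g * y)%g) x.
Proof.
move=> sf; have [c ac cg] := atlas_cover g; have [d ad dx] := atlas_cover x.
have [e ae egx] := atlas_cover (g * x)%g.
have s := mul_smooth ac ad ae cg dx egx.
have s2 : smooth_at (fun w : E => (cmap c g, w)) (cmap d x).
  by apply: smooth_at_pair; [exact: smooth_at_cst|exact: smooth_at_id].
have s3 := smooth_at_comp (has_coords_prod hE hE) hE s2 s.
exists d; split=> //.
have s4 : smooth_at ((f \o cinv e : E -> R^o) \o
   ((fun z : E * E => cmap e (cinv c z.1 * cinv d z.2)%g) \o (fun w : E => (cmap c g, w))))
   (cmap d x).
  by apply: (smooth_at_comp hE hR s3); rewrite /= !cmap_cinv//; exact: gsmooth_at_chart.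
apply: smooth_at_eq s4.
have C : (g * cinv d w)%g @[w --> cmap d x] --> (g * x)%g.
  rewrite -[in X in _ --> X](cmap_cinv dx).
  exact: cvg_comp (cinv_continuous_at (cimg_cmap dx)) (@mulgl_continuous g _).
have : \forall w \near cmap d x, cdom e (g * cinv d w)%g.
  exact: C _ (cdom_near egx).
by apply: filterS => w ew /=; rewrite (cmap_cinv cg) cmap_cinv.
Qed.

Lemma gsmooth_at_mulgr f g x : gsmooth_at f (x * g)%g ->
  gsmooth_at (fun y => f (y * g)%g) x.
Proof.
move=> sf; have [c ac cg] := atlas_cover g; have [d ad dx] := atlas_cover x.
have [e ae egx] := atlas_cover (x * g)%g.
have s := mul_smooth ad ac ae dx cg egx.
have s2 : smooth_at (fun w : E => (w, cmap c g)) (cmap d x).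
  by apply: smooth_at_pair; [exact: smooth_at_id|exact: smooth_at_cst].
have s3 := smooth_at_comp (has_coords_prod hE hE) hE s2 s.
exists d; split=> //.
have s4 : smooth_at ((f \o cinv e : E -> R^o) \o
   ((fun z : E * E => cmap e (cinv d z.1 * cinv c z.2)%g) \o (fun w : E => (w, cmap c g))))
   (cmap d x).
  by apply: (smooth_at_comp hE hR s3); rewrite /= !cmap_cinv//; exact: gsmooth_at_chart.
apply: smooth_at_eq s4.
have C : (cinv d w * g)%g @[w --> cmap d x] --> (x * g)%g.
  rewrite -[in X in _ --> X](cmap_cinv dx).
  exact: cvg_comp (cinv_continuous_at (cimg_cmap dx)) (@mulgr_continuous g _).
have : \forall w \near cmap d x, cdom e (cinv d w * g)%g.
  exact: C _ (cdom_near egx).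
by apply: filterS => w ew /=; rewrite (cmap_cinv cg) cmap_cinv.
Qed.

End GroupSmoothness.

(** * Partial derivatives on products and differentiation along a varying direction *)

Section PartialDerivatives.
Variables (R : realType).
Implicit Types (U V W : normedModType R).

Lemma derive_pair1 U V W (F : U * V -> W) x y u :
  'D_(u, 0) F (x, y) = 'D_u (fun x => F (x, y)) x.
Proof.
rewrite /derive.
have -> : (fun h : R => h^-1 *: ((F \o shift (x, y)) (h *: (u, 0)) - F (x, y))) =
  (fun h : R => h^-1 *: (((fun x => F (x, y)) \o shift x) (h *: u) - F (x, y))); last by [].
apply/funext => h /=.
by rewrite -[h *: (u, 0)]/(h *: u, h *: 0) scaler0 -[X in F X]/(_, 0 + y) add0r.
Qed.

Lemma derive_pair2 U V W (F : U * V -> W) x y v :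
  'D_(0, v) F (x, y) = 'D_v (fun y => F (x, y)) y.
Proof.
rewrite /derive.
have -> : (fun h : R => h^-1 *: ((F \o shift (x, y)) (h *: (0, v)) - F (x, y))) =
  (fun h : R => h^-1 *: (((fun y => F (x, y)) \o shift y) (h *: v) - F (x, y))); last by [].
apply/funext => h /=.
by rewrite -[h *: (0, v)]/(h *: 0, h *: v) scaler0 -[X in F X]/(0 + x, _) add0r.
Qed.

Lemma smooth_at_pairl U V (x : U) (y : V) : smooth_at (fun x => (x, y)) x.
Proof. by apply: smooth_at_pair; [exact: smooth_at_id|exact: smooth_at_cst]. Qed.

Lemma smooth_at_pairr U V (x : U) (y : V) : smooth_at (fun y => (x, y)) y.
Proof. by apply: smooth_at_pair; [exact: smooth_at_cst|exact: smooth_at_id]. Qed.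

Lemma smooth_derive_comp U V W (f : U -> V) (g : V -> W) x v :
  has_coords V -> has_coords W -> smooth_at f x -> smooth_at g (f x) ->
  'D_v (g \o f) x = 'D_('D_v f x) g (f x).
Proof.
move=> cV cW sf sg.
by have [_ ->] := @is_derive_comp R U V W f g x v _
  (derivableP (smooth_at_derivable sf)) (smooth_at_differentiable cV cW sg).
Qed.

Lemma smooth_derive2_lin U V W (f : U -> V) (L : {linear V -> W}) x u v :
  continuous L -> smooth_at f x -> 'D_u ('D_v (L \o f)) x = L ('D_u ('D_v f) x).
Proof.
move=> cL sf.
have E : \forall y \near x, (L \o 'D_v f) y = 'D_v (L \o f) y.
  apply: filterS (smooth_at_near sf) => y sy.
  by have [_ ->] := is_derive_lin cL (derivableP (smooth_at_derivable (v := v) sy)).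
rewrite -(near_eq_derive _ E).
by have [_ ->] := is_derive_lin cL (derivableP (smooth_at_derivable (v := u) (smooth_at_derive v sf))).
Qed.

Lemma derive_linear_dir U V (f : U -> V) x u v : differentiable f x ->
  'D_(u - v) f x = 'D_u f x - 'D_v f x.
Proof. by move=> df; rewrite !deriveE// linearB. Qed.

(** This is the product rule for a direction that depends on the point: expanded in coordinates, one
    term differentiates h with the direction frozen at [B x], the other differentiates the
    direction. *)
Lemma smooth_derive_along U W (B : U -> U) (h : U -> W) x a :
  has_coords U -> has_coords W -> smooth_at B x -> smooth_at h x ->
  'D_a (fun z => 'D_(B z) h z) x = 'D_a ('D_(B x) h) x + 'D_('D_a B x) h x.
Proof.
move=> cU cW sB sh; case: (cU) => [m [e [l [cl le]]]].
have dh z w : smooth_at h z -> 'D_w h z = \sum_i l i w *: 'D_(e i) h z.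
  move=> sz; have D : differentiable h z by exact: smooth_at_differentiable.
  by have := derive_coords (fun i => l i w) e D; rewrite -le.
have E : \forall z \near x,
    (\sum_i (fun z => (l i \o B) z *: 'D_(e i) h z)) z = 'D_(B z) h z.
  by apply: filterS (smooth_at_near sh) => z sz; rewrite fct_sumE dh.
rewrite -(near_eq_derive _ E).
have dlB i := is_derive_lin (cl i) (derivableP (smooth_at_derivable (v := a) sB)).
have dDh i := derivableP (smooth_at_derivable (v := a) (smooth_at_derive (e i) sh)).
have [_ ->] := is_derive_sum (fun i => is_derive_scale (dlB i) (dDh i)).
(* Symmetry moves a inside, so that the sum over i is the expansion of a single direction for the
   differentiable map ['D_a h], and then moves it back. *)
have A : \sum_i (l i \o B) x *: 'D_a ('D_(e i) h) x = 'D_a ('D_(B x) h) x.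
  rewrite (smooth_at_symmetric _ _ cW sh).
  have D : differentiable ('D_a h) x by exact/smooth_at_differentiable/smooth_at_derive.
  have := derive_coords (fun i => l i (B x)) e D; rewrite -le => ->.
  by apply: eq_bigr => i _; rewrite (smooth_at_symmetric _ _ cW sh).
by rewrite big_split/= A -dh.
Qed.

End PartialDerivatives.

(** * Invariant vector fields in a chart at the identity *)

Section BaseChart.
Variables (R : realType) (n : nat) (G : lieGroupType R n).
Local Notation E := 'rV[R]_n.
Local Notation atlas := (@atlas R n G).
Implicit Types (f : G -> R^o) (x y g : G) (z w u a b : E).

Let hE := has_coords_rV R n.
Let hR := has_coords_R R.
Let hEE := has_coords_prod hE hE.

Variable c : chart R n G.
Hypotheses (ac : atlas c) (c1 : cdom c 1%g).

Let p : E := cmap c 1%g.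

Let cp : cimg c p. Proof. exact: cimg_cmap. Qed.

Let cinvp : cinv c p = 1%g. Proof. exact: cmap_cinv. Qed.

(** The group law in coordinates. It is meaningful only where the product stays in the domain of the
    chart, hence the [cdom] conditions on its arguments. *)
Definition chart_mul (z : E * E) : E := cmap c (cinv c z.1 * cinv c z.2)%g.
Local Notation mu := chart_mul.

Lemma chart_mul_smooth z w : cimg c z -> cimg c w -> cdom c (cinv c z * cinv c w)%g ->
  smooth_at mu (z, w).
Proof.
move=> cz cw czw; rewrite -[in X in smooth_at _ X](cinvK cz) -[in X in smooth_at _ X](cinvK cw).
exact: mul_smooth ac ac ac (cdom_cinv cz) (cdom_cinv cw) czw.
Qed.

Lemma chart_mulp z : cimg c z -> mu (z, p) = z.
Proof. by move=> cz; rewrite /mu /= cinvp mulg1 cinvK. Qed.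

Lemma chart_pmul z : cimg c z -> mu (p, z) = z.
Proof. by move=> cz; rewrite /mu /= cinvp mul1g cinvK. Qed.

Lemma chart_mulp_smooth z : cimg c z -> smooth_at mu (z, p).
Proof.
by move=> cz; apply: chart_mul_smooth => //; rewrite cinvp mulg1; exact: cdom_cinv.
Qed.

Lemma chart_pmul_smooth z : cimg c z -> smooth_at mu (p, z).
Proof.
by move=> cz; apply: chart_mul_smooth => //; rewrite cinvp mul1g; exact: cdom_cinv.
Qed.

(* The left- and right-invariant vector fields with value a at the identity. *)
Definition leftX (a z : E) : E := 'D_(0, a) mu (z, p).
Definition rightX (a z : E) : E := 'D_(a, 0) mu (p, z).

Lemma leftX_smooth a z : cimg c z -> smooth_at (leftX a) z.
Proof.
move=> cz; have s := smooth_at_derive (0, a) (chart_mulp_smooth cz).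
exact: (smooth_at_comp hEE hE (smooth_at_pairl z p) s).
Qed.

Lemma rightX_smooth a z : cimg c z -> smooth_at (rightX a) z.
Proof.
move=> cz; have s := smooth_at_derive (a, 0) (chart_pmul_smooth cz).
exact: (smooth_at_comp hEE hE (smooth_at_pairr p z) s).
Qed.

Lemma leftXp a : leftX a p = a.
Proof.
rewrite /leftX derive_pair2 -[RHS](derive_id p a); apply: near_eq_derive.
by apply: filterS (cimg_near cp) => z; exact: chart_pmul.
Qed.

Lemma rightXp a : rightX a p = a.
Proof.
rewrite /rightX derive_pair1 -[RHS](derive_id p a); apply: near_eq_derive.
by apply: filterS (cimg_near cp) => z; exact: chart_mulp.
Qed.

(** The tangent vector with coordinates a. It is cut off by [on_germs] just as [velocity] is, so
    that the two can be equal as functionals. *)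
Definition chart_vector (a : E) : tangent_vector G :=
  on_germs (fun f => 'D_a (f \o cinv c : E -> R^o) p).

Lemma velocityE (gamma : R^o -> G) (b : E) : {for 0, continuous gamma} ->
  gamma 0 = 1%g -> is_derive (0 : R^o) 1 (cmap c \o gamma) b ->
  velocity gamma = chart_vector b.
Proof.
move=> cg g0 dg; apply/funext => f; rewrite /velocity /chart_vector /on_germs.
case: ifPn => // /asboolP/smooth_near1E sf.
have s := gsmooth_at_chart sf ac c1.
rewrite derive1E.
have N : \forall t \near (0 : R^o), ((f \o cinv c : E -> R^o) \o (cmap c \o gamma)) t = (f \o gamma) t.
  have : \forall t \near (0 : R^o), cdom c (gamma t).
    by apply: cg; rewrite g0; exact: cdom_near.
  by apply: filterS => t ct /=; rewrite cmap_cinv.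
rewrite -(near_eq_derive _ N).
have s' : smooth_at (f \o cinv c : E -> R^o) ((cmap c \o gamma) 0) by rewrite /= g0.
have [_ ->] := is_derive_comp dg (smooth_at_differentiable hE hR s').
by rewrite /= g0.
Qed.

Lemma smooth_curve_smooth eps (gamma : R^o -> G) t : smooth_curve eps gamma ->
  `|t| < eps -> cdom c (gamma t) -> smooth_at (cmap c \o gamma : R^o -> E) t.
Proof.
move=> [cg sg] teps ct; apply: smooth_on_near (sg c ac) _.
have H : \forall s \near (t : R^o), `|s| < eps.
  by apply: open_nbhs_nbhs; split=> //; exact: open_norm_lt.
have : \forall s \near (t : R^o), cdom c (gamma s).
  by apply: (cg t); [rewrite inE|exact: cdom_near].
by apply: filterS2 H => s.
Qed.

Lemma lie_algebra_chart_vector xi : lie_algebra [set: G] xi ->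
  exists a, xi = chart_vector a.
Proof.
move=> [eps [gamma [eps0 sg g0 _ ->]]]; exists ('D_1 (cmap c \o gamma : R^o -> E) 0).
have e0 : `|0 : R| < eps by rewrite normr0.
apply: velocityE => //; first by have [cg _] := sg; apply: cg; rewrite inE.
apply/derivableP/smooth_at_derivable/(smooth_curve_smooth sg e0).
by rewrite g0.
Qed.

Lemma chart_mul_near z : cimg c z -> \forall w \near p, cdom c (cinv c z * cinv c w)%g.
Proof.
move=> cz; apply: (@cinv_near _ _ _ _ p (fun x => cdom c (cinv c z * x)%g)) => //.
apply: (@mulgl_continuous R n G (cinv c z)); rewrite cinvp mulg1.
exact/cdom_near/cdom_cinv.
Qed.

Lemma chart_mulr_near z : cimg c z -> \forall w \near p, cdom c (cinv c w * cinv c z)%g.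
Proof.
move=> cz; apply: (@cinv_near _ _ _ _ p (fun x => cdom c (x * cinv c z)%g)) => //.
apply: (@mulgr_continuous R n G (cinv c z)); rewrite cinvp mul1g.
exact/cdom_near/cdom_cinv.
Qed.

(** This identifies [leftX] with the left-invariant field of the definitions: by the chain rule,
    differentiating f after left translation at p is differentiating f at z along the translated
    vector. *)
Lemma chart_vector_mull f z a : cimg c z -> gsmooth_at f (cinv c z) ->
  chart_vector a (fun y => f (cinv c z * y)%g) = 'D_(leftX a z) (f \o cinv c : E -> R^o) z.
Proof.
move=> cz sf; rewrite /chart_vector /on_germs asboolT; last first.
  by apply/smooth_near1E/gsmooth_at_mulgl; rewrite mulg1.
have sfz : smooth_at (f \o cinv c : E -> R^o) z.
  by have := gsmooth_at_chart sf ac (cdom_cinv cz); rewrite cinvK.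
have N : \forall w \near p, ((f \o cinv c : E -> R^o) \o (fun w => mu (z, w))) w =
    ((fun y => f (cinv c z * y)%g) \o cinv c) w.
  by apply: filterS (chart_mul_near cz) => w cw /=; rewrite cmap_cinv.
rewrite -(near_eq_derive _ N).
have s2 : smooth_at (fun w => mu (z, w)) p.
  exact: (smooth_at_comp hEE hE (smooth_at_pairr z p) (chart_mulp_smooth cz)).
have s3 : smooth_at (f \o cinv c : E -> R^o) (mu (z, p)) by rewrite chart_mulp.
apply: etrans (smooth_derive_comp a hE hR s2 s3) _.
by rewrite (chart_mulp cz) /leftX derive_pair2.
Qed.

Lemma chart_vector_mulr f z a : cimg c z -> gsmooth_at f (cinv c z) ->
  chart_vector a (fun y => f (y * cinv c z)%g) = 'D_(rightX a z) (f \o cinv c : E -> R^o) z.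
Proof.
move=> cz sf; rewrite /chart_vector /on_germs asboolT; last first.
  by apply/smooth_near1E/gsmooth_at_mulgr; rewrite mul1g.
have sfz : smooth_at (f \o cinv c : E -> R^o) z.
  by have := gsmooth_at_chart sf ac (cdom_cinv cz); rewrite cinvK.
have N : \forall w \near p, ((f \o cinv c : E -> R^o) \o (fun w => mu (w, z))) w =
    ((fun y => f (y * cinv c z)%g) \o cinv c) w.
  by apply: filterS (chart_mulr_near cz) => w cw /=; rewrite cmap_cinv.
rewrite -(near_eq_derive _ N).
have s2 : smooth_at (fun w => mu (w, z)) p.
  exact: (smooth_at_comp hEE hE (smooth_at_pairl p z) (chart_pmul_smooth cz)).
have s3 : smooth_at (f \o cinv c : E -> R^o) (mu (p, z)) by rewrite chart_pmul.
apply: etrans (smooth_derive_comp a hE hR s2 s3) _.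
by rewrite (chart_pmul cz) /rightX derive_pair1.
Qed.

Section LinearTest.
Variables (l : {linear E -> R^o}) (cl : continuous l).

Lemma linear_test_near z : cimg c z ->
  \forall w \near z, l w = ((l \o cmap c : G -> R^o) \o cinv c : E -> R^o) w.
Proof. by move=> cz; apply: filterS (cimg_near cz) => w cw /=; rewrite cinvK. Qed.

Lemma smooth_at_linear_form z : smooth_at (l : E -> R^o) z.
Proof. exact: (smooth_at_linear cl (@smooth_at_id R E z)). Qed.

(** Coordinate functions of the chart are the test functions that recover a vector from its
    functional. They are smooth on the chart domain, which contains 1. *)
Lemma gsmooth_at_linear_test x : cdom c x -> gsmooth_at (l \o cmap c : G -> R^o) x.
Proof.
move=> cx; exists c; split=> //.
exact: smooth_at_eq (linear_test_near (cimg_cmap cx)) (smooth_at_linear_form _).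
Qed.

Lemma derive_linear_form z v : 'D_v (l : E -> R^o) z = l v.
Proof.
by have [_] := is_derive_lin cl (is_derive_id z v).
Qed.

Lemma derive_linear_test z v : cimg c z ->
  'D_v ((l \o cmap c : G -> R^o) \o cinv c : E -> R^o) z = l v.
Proof.
by move=> cz; rewrite -(near_eq_derive _ (linear_test_near cz)) derive_linear_form.
Qed.

End LinearTest.

Lemma Ad_chart_vector z a : cimg c z ->
  Ad (cinv c z) (chart_vector a) = chart_vector a <-> leftX a z = rightX a z.
Proof.
move=> cz; set g := cinv c z; have cg : cdom c g by exact: cdom_cinv.
split=> [H|H].
  case: hE => m [e [l [cl le]]]; apply: (coords_eq le) => i.
  have sF := gsmooth_at_linear_test (cl i) cg.
  rewrite -(derive_linear_test (cl i) (leftX a z) cz).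
  rewrite -(derive_linear_test (cl i) (rightX a z) cz).
  rewrite -(chart_vector_mull a cz sF) -(chart_vector_mulr a cz sF).
  (* Evaluating the equation at the test function composed with right translation by g cancels the
     factor g^-1 of the conjugation. *)
  apply: etrans _ (congr1 (fun v => v (fun y => (l i \o cmap c) (y * g)%g)) H).
  rewrite /Ad; congr (chart_vector a _); apply/funext => x.
  by rewrite mulgVK.
apply/funext => f; rewrite /Ad.
have [sf|nsf] := pselect (smooth_near1 f).
  have sF : gsmooth_at (fun y => f (y * g^-1)%g) g.
    by apply: gsmooth_at_mulgr; rewrite mulgV; exact/smooth_near1E.
  have E1 := chart_vector_mull a cz sF; have E2 := chart_vector_mulr a cz sF.
  apply: etrans E1 _; rewrite H -E2.
  congr (chart_vector a _); apply/funext => x.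
  by rewrite mulgK.
(* Where f is not smooth near 1, both sides are 0: conjugating back by g^-1 would otherwise carry
   smoothness of the conjugated function to f. *)
rewrite /chart_vector /on_germs !asboolF// => /smooth_near1E sf; apply: nsf.
apply/smooth_near1E.
have s1 : gsmooth_at (fun y => f (g * (g^-1 * y) * g^-1)%g) g.
  by apply: (@gsmooth_at_mulgl R n G (fun x => f (g * x * g^-1)%g)); rewrite mulVg.
have s2 : gsmooth_at (fun y => f (g * (g^-1 * (y * g)) * g^-1)%g) 1%g.
  by apply: (@gsmooth_at_mulgr R n G (fun y => f (g * (g^-1 * y) * g^-1)%g)); rewrite mul1g.
have E : (fun y => f (g * (g^-1 * (y * g)) * g^-1)%g) = f.
  by apply/funext => y; rewrite mulgA mulgV mul1g mulgK.
by rewrite E in s2.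
Qed.

Lemma derive_left f z b : smooth_at (f \o cinv c : E -> R^o) z -> cimg c z ->
  'D_(0, b) ((f \o cinv c : E -> R^o) \o mu) (z, p) =
  'D_(leftX b z) (f \o cinv c : E -> R^o) z.
Proof.
move=> sf cz; have s3 : smooth_at (f \o cinv c : E -> R^o) (mu (z, p)) by rewrite chart_mulp.
apply: etrans (smooth_derive_comp (0, b) hE hR (chart_mulp_smooth cz) s3) _.
by rewrite (chart_mulp cz).
Qed.

Lemma derive_right f z b : smooth_at (f \o cinv c : E -> R^o) z -> cimg c z ->
  'D_(b, 0) ((f \o cinv c : E -> R^o) \o mu) (p, z) =
  'D_(rightX b z) (f \o cinv c : E -> R^o) z.
Proof.
move=> sf cz; have s3 : smooth_at (f \o cinv c : E -> R^o) (mu (p, z)) by rewrite chart_pmul.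
apply: etrans (smooth_derive_comp (b, 0) hE hR (chart_pmul_smooth cz) s3) _.
by rewrite (chart_pmul cz).
Qed.

Lemma chart_mul_comp_smooth f : smooth_near1 f ->
  smooth_at ((f \o cinv c : E -> R^o) \o mu) (p, p).
Proof.
move=> /smooth_near1E sf; apply: (smooth_at_comp hE hR (chart_mulp_smooth cp)).
by rewrite (chart_mulp cp); exact: gsmooth_at_chart.
Qed.

Lemma left_field_chart f b : smooth_near1 f ->
  \forall z \near p, 'D_(0, b) ((f \o cinv c : E -> R^o) \o mu) (z, p) =
    ((left_field (chart_vector b) f : G -> R^o) \o cinv c) z.
Proof.
move=> /smooth_near1E sf.
have := smooth_at_near (gsmooth_at_chart sf ac c1); rewrite -/p.
apply: filterS2 (cimg_near cp) => z cz sz.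
apply: etrans (derive_left b sz cz) _; apply/esym/(chart_vector_mull b cz).
by exists c; rewrite cinvK//; split=> //; exact: cdom_cinv.
Qed.

(** Two left-invariant derivatives of f at 1 become one mixed second derivative, at (p, p), of f
    composed with the group law: the inner field differentiates the second slot, the outer vector
    the first. *)
Lemma chart_vector_left_field f a b : smooth_near1 f ->
  chart_vector a (left_field (chart_vector b) f) =
  'D_(a, 0) ('D_(0, b) ((f \o cinv c : E -> R^o) \o mu)) (p, p).
Proof.
move=> sf; have N := left_field_chart b sf.
have s := smooth_at_derive (0, b) (chart_mul_comp_smooth sf).
have s' := smooth_at_comp hEE hR (smooth_at_pairl p p) s.
rewrite /chart_vector /on_germs asboolT; last first.
  apply/smooth_near1E; exists c; split=> //.
  exact: smooth_at_eq N s'.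
by rewrite -/p -(near_eq_derive _ N) derive_pair1.
Qed.

Lemma lie_bracket_chart f a b : smooth_near1 f ->
  lie_bracket (chart_vector a) (chart_vector b) f =
  'D_(a, 0) ('D_(0, b) ((f \o cinv c : E -> R^o) \o mu)) (p, p) -
  'D_(b, 0) ('D_(0, a) ((f \o cinv c : E -> R^o) \o mu)) (p, p).
Proof.
by move=> sf; rewrite /lie_bracket {1}/on_germs asboolT// !chart_vector_left_field.
Qed.

(** Write psi for f composed with the group law. On the centralizer the a-derivative of psi in the
    second slot at (gamma t, p) equals the one in the first slot at (p, gamma t). Differentiating at
    t = 0 puts b in the opposite slot on each side, and Schwarz's theorem turns the result into the
    vanishing of the bracket on f. *)
Lemma bracket_centralizer (a b : E) (eps : R) (gamma : R^o -> G) :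
  0 < eps -> {for 0, continuous gamma} -> gamma 0 = 1%g ->
  is_derive (0 : R^o) 1 (cmap c \o gamma) b ->
  (forall t : R, `|t| < eps -> CM (chart_vector a) (gamma t)) ->
  lie_bracket (chart_vector a) (chart_vector b) = (fun=> 0).
Proof.
move=> eps0 cg g0 dg CMg; apply/funext => f.
have [sf|nsf] := pselect (smooth_near1 f); last by rewrite /lie_bracket /on_germs asboolF.
apply: etrans (lie_bracket_chart a b sf) _.
pose psi : E * E -> R^o := (f \o cinv c : E -> R^o) \o mu.
rewrite -/psi.
have spsi : smooth_at psi (p, p) by exact: chart_mul_comp_smooth.
have sfc : smooth_at (f \o cinv c : E -> R^o) p.
  by apply: gsmooth_at_chart => //; exact/smooth_near1E.
have cgN (P : G -> Prop) : (\forall x \near (1%g : G), P x) ->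
    \forall t \near (0 : R^o), P (gamma t).
  by rewrite -g0 => /cg.
have H1 := cgN _ (cdom_near c1).
have H2 : \forall t \near (0 : R^o), smooth_at (f \o cinv c : E -> R^o) (cmap c (gamma t)).
  apply: (cgN (fun x => smooth_at (f \o cinv c : E -> R^o) (cmap c x))).
  by apply: cmap_near => //; exact: smooth_at_near.
have H3 : \forall t \near (0 : R^o), `|t| < eps.
  apply/nbhs_ballP; exists eps => // t; rewrite /ball /= sub0r normrN.
  exact.
have N : \forall t \near (0 : R^o),
    ('D_(0, a) psi \o (fun t => ((cmap c \o gamma) t, p))) t =
    ('D_(a, 0) psi \o (fun t => (p, (cmap c \o gamma) t))) t.
  apply: filterS3 H1 H2 H3 => t ct st teps /=.
  have cy := cimg_cmap ct.
  apply: etrans (derive_left a st cy) (etrans _ (esym (derive_right a st cy))).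
  have /Ad_chart_vector -> // : Ad (cinv c (cmap c (gamma t))) (chart_vector a) = chart_vector a.
  by rewrite cmap_cinv//; exact: CMg.
have dl : is_derive (0 : R^o) 1 (fun t : R^o => ((cmap c \o gamma) t, p)) (b, 0).
  by apply: is_derive_pair => //; exact: is_derive_cst.
have dr : is_derive (0 : R^o) 1 (fun t : R^o => (p, (cmap c \o gamma) t)) (0, b).
  by apply: is_derive_pair => //; exact: is_derive_cst.
have y0 : (cmap c \o gamma) 0 = p by rewrite /= g0.
have Dl : differentiable ('D_(0, a) psi) ((cmap c \o gamma) 0, p).
  by rewrite y0; apply: (smooth_at_differentiable hEE hR); exact: smooth_at_derive.
have Dr : differentiable ('D_(a, 0) psi) (p, (cmap c \o gamma) 0).
  by rewrite y0; apply: (smooth_at_differentiable hEE hR); exact: smooth_at_derive.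
have [_ El] := is_derive_comp dl Dl; have [_ Er] := is_derive_comp dr Dr.
rewrite y0 in El Er; have S := smooth_at_symmetric (a, 0) (0, b) hR spsi.
have E1 := near_eq_derive (1 : R^o) N.
have E2 := etrans (esym E1) El.
have E3 := etrans (esym Er) E2.
have E4 := etrans S E3.
apply/eqP; rewrite subr_eq0. apply/eqP.
exact: E4.
Qed.

(* The derivative at w = p of the associativity law u (z w) = (u z) w. *)
Lemma leftX_mul u z b : cimg c u -> cimg c z -> cdom c (cinv c u * cinv c z)%g ->
  leftX b (mu (u, z)) = 'D_(0, leftX b z) mu (u, z).
Proof.
move=> cu cz cuz; have cm : cimg c (mu (u, z)) by exact: cimg_cmap.
have N : \forall w \near p, mu (mu (u, z), w) = ((fun w => mu (u, w)) \o (fun w => mu (z, w))) w.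
  apply: filterS (chart_mul_near cz) => w czw.
  by rewrite /chart_mul /= !cmap_cinv// mulgA.
rewrite [in LHS]/leftX !derive_pair2 (near_eq_derive _ N).
have s1 : smooth_at (fun w => mu (z, w)) p.
  exact: (smooth_at_comp hEE hE (smooth_at_pairr z p) (chart_mulp_smooth cz)).
have s2 : smooth_at (fun w => mu (u, w)) (mu (z, p)).
  rewrite chart_mulp//.
  exact: (smooth_at_comp hEE hE (smooth_at_pairr u z) (chart_mul_smooth cu cz cuz)).
apply: etrans (smooth_derive_comp b hE hE s1 s2) _.
by rewrite (chart_mulp cz) /leftX derive_pair2.
Qed.

(** Left and right translations commute. Here [leftX_mul] is differentiated in u at p along a; with
    z fixed the direction [leftX b z] is constant, so the right-hand side is a mixed second
    derivative of the group law, and exchanging its order gives the claim. *)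
Lemma leftX_rightX_commute a b z : cimg c z ->
  'D_(rightX a z) (leftX b) z = 'D_(leftX b z) (rightX a) z.
Proof.
move=> cz.
have N : \forall u \near p, (leftX b \o (fun u => mu (u, z))) u =
    ('D_(0, leftX b z) mu \o (fun u => (u, z))) u.
  apply: filterS2 (cimg_near cp) (chart_mulr_near cz) => u cu cuz.
  exact: leftX_mul.
have s1 : smooth_at (fun u => mu (u, z)) p.
  exact: (smooth_at_comp hEE hE (smooth_at_pairl p z) (chart_pmul_smooth cz)).
have s2 : smooth_at (leftX b) (mu (p, z)) by rewrite chart_pmul//; exact: leftX_smooth.
have L := smooth_derive_comp a hE hE s1 s2.
rewrite (chart_pmul cz) -derive_pair1 -/(rightX a z) in L.
have S := smooth_at_symmetric (a, 0) (0, leftX b z) hE (chart_pmul_smooth cz).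
have E1 := etrans (esym L) (near_eq_derive a N).
have E2 := esym (derive_pair1 ('D_(0, leftX b z) mu) p z a).
have E3 := derive_pair2 ('D_(a, 0) mu) p z (leftX b z).
have E4 := etrans S E3.
have E5 := etrans E1 E2.
have E6 := etrans E5 E4.
exact: E6.
Qed.

(* Left translation by u carries the bracket of the two fields at p to their
   bracket at u. *)
Lemma leftX_commute a b u : cimg c u -> 'D_a (leftX b) p = 'D_b (leftX a) p ->
  'D_(leftX a u) (leftX b) u = 'D_(leftX b u) (leftX a) u.
Proof.
move=> cu H.
pose h w := mu (u, w).
have sh : smooth_at h p.
  exact: (smooth_at_comp hEE hE (smooth_at_pairr u p) (chart_mulp_smooth cu)).
have hp : h p = u by exact: chart_mulp.
have dh a' : 'D_a' h p = leftX a' u by rewrite /leftX derive_pair2.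
(* The second-order term is symmetric in the two vectors, and the other term is covered by the
   hypothesis at p. *)
have K a' b' : 'D_(leftX a' u) (leftX b') u =
    'D_a' ('D_b' h) p + 'D_('D_a' (leftX b') p) h p.
  have N : \forall z \near p, (leftX b' \o h) z = 'D_(leftX b' z) h z.
    apply: filterS2 (cimg_near cp) (chart_mul_near cu) => z cz cuz.
    by have E1 := leftX_mul b' cu cz cuz; rewrite derive_pair2 in E1; exact: E1.
  have s2 : smooth_at (leftX b') (h p) by rewrite hp; exact: leftX_smooth.
  have L := smooth_derive_comp a' hE hE sh s2.
  rewrite hp dh in L.
  have A := smooth_derive_along a' hE hE (leftX_smooth b' cp) sh.
  rewrite leftXp in A; have E1 := etrans (esym L) (near_eq_derive a' N).
  exact: etrans E1 A.
have S := smooth_at_symmetric a b hE sh.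
have E1 := congr2 (fun v w : E => v + 'D_w h p) S H.
have E2 := etrans (K a b) E1.
exact: etrans E2 (esym (K b a)).
Qed.

(** Tested on the coordinate functions of the chart, the bracket gives the coordinates of the
    classical commutator of the two fields at p. *)
Lemma bracket0_leftX a b : lie_bracket (chart_vector a) (chart_vector b) = (fun=> 0) ->
  'D_a (leftX b) p = 'D_b (leftX a) p.
Proof.
move=> H; case: hE => m [e [l [cl le]]]; apply: (coords_eq le) => i.
pose F : G -> R^o := l i \o cmap c.
have sF : smooth_near1 F by apply/smooth_near1E/gsmooth_at_linear_test.
have N : \forall z \near (p, p), (l i \o mu) z = ((F \o cinv c : E -> R^o) \o mu) z.
  have H0 : \forall w \near mu (p, p), l i w = (F \o cinv c : E -> R^o) w.
    by apply: linear_test_near; rewrite chart_mulp.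
  exact: (smooth_at_continuous (chart_mulp_smooth cp)) _ H0.
have D a' b' : 'D_(a', 0) ('D_(0, b') ((F \o cinv c : E -> R^o) \o mu)) (p, p) =
    l i ('D_a' (leftX b') p).
  have N2 : \forall z \near (p, p),
      'D_(0, b') (l i \o mu) z = 'D_(0, b') ((F \o cinv c : E -> R^o) \o mu) z.
    (* Second derivatives are compared, so the functions must agree near every point close to (p,
       p); an open set provides this. *)
    have [U [oU Up UP]] := near_open N.
    apply: filterS (open_near oU Up) => z Uz; apply: near_eq_derive.
    by apply: filterS (open_near oU Uz).
  rewrite -(near_eq_derive _ N2) (smooth_derive2_lin _ _ (cl i) (chart_mulp_smooth cp)).
  by rewrite derive_pair1.
have B := etrans (esym (lie_bracket_chart a b sF)) (congr1 (fun v => v F) H).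
have {}B : 'D_(a, 0) ('D_(0, b) ((F \o cinv c : E -> R^o) \o mu)) (p, p) =
    'D_(b, 0) ('D_(0, a) ((F \o cinv c : E -> R^o) \o mu)) (p, p).
  by apply/eqP; rewrite -subr_eq0; apply/eqP; exact: B.
exact: etrans (esym (D a b)) (etrans B (D b a)).
Qed.

End BaseChart.

(** Bootstrapping: the derivative of y is Y composed with y, which is of class C^k as soon as y is,
    so y is of class C^(k+1). *)
Lemma integral_curve_smooth (R : realType) n (Y : 'rV[R]_n -> 'rV[R]_n)
    (y : R^o -> 'rV[R]_n) (U : set R^o) : open U ->
  (forall t, U t -> smooth_at Y (y t)) ->
  (forall t : R^o, U t -> is_derive t (1 : R^o) y (Y (y t))) -> smooth_on U y.
Proof.
move=> oU sY dy; have hE := has_coords_rV R n.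
pose S := [set z | smooth_at Y z].
have oS : open S by exact: open_smooth_at.
have sS : smooth_on S Y by exact: smooth_at_on.
have cy t : U t -> {for t, continuous y}.
  by move=> /dy[/derivable1_diffP/differentiable_continuous].
elim=> [|k IH]; first by split=> // t /[!inE]; exact: cy.
split=> [t /[!inE]|v]; first exact: cy.
have D t : U t -> is_derive t v y (v *: Y (y t)).
  by move=> /dy[d <-]; have := deriveZv v d; rewrite [v *: 1]mulr1.
split=> [t /[!inE]/D[]//|].
have Ck : Ck_on k U (fun t => (cst v : R^o -> R^o) t *: (Y \o y) t).
  apply: Ck_onZ => //; first exact: Ck_on_cst.
  by apply: (Ck_on_comp hE hE oU oS) => //; exact: sS.
by apply: Ck_on_eq Ck => // t /[!inE]/D[_ ->].
Qed.

(** * The integral curve through the identity *)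

Section CentralizerFlow.
Variables (R : realType) (n : nat) (G : lieGroupType R n).
Local Notation E := 'rV[R]_n.
Variable c : chart R n G.
Hypotheses (ac : atlas c) (c1 : cdom c 1%g).

Let hE := has_coords_rV R n.
Let p : E := cmap c 1%g.
Let cp : cimg c p. Proof. exact: cimg_cmap. Qed.

Lemma chart_curve_smooth (y : R^o -> E) (eps : R) :
  smooth_on [set t : R^o | `|t| < eps] y ->
  (forall t : R^o, `|t| < eps -> cimg c (y t)) ->
  smooth_curve eps (cinv c \o y).
Proof.
move=> sy cy.
have oU := @open_norm_lt R R^o eps.
split=> [t /[!inE] te|d ad].
  apply: continuous_comp; last exact/cinv_continuous_at/cy.
  by apply: smooth_at_continuous; exact: smooth_on_at sy te.
apply: smooth_at_on => t [te dt].
have st : smooth_at y t by exact: smooth_on_at sy te.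
have cyt := cy t te.
have sd := chart_change_smooth ac ad (cdom_cinv cyt) dt.
rewrite /= (cinvK cyt) in sd.
exact: smooth_at_comp hE hE st sd.
Qed.

Lemma centralizer_flow a b :
  lie_bracket (chart_vector c a) (chart_vector c b) = (fun=> 0) ->
  lie_algebra (CM (chart_vector c a)) (chart_vector c b).
Proof.
move=> br; have H := bracket0_leftX ac c1 br.
have sX : smooth_at (leftX c b) p by exact: leftX_smooth.
have [y [e0 [e0_gt0 y0 dy]]] := ode_local sX.
have [L L0 LP] := derive_bounded hE hE sX.
have cty : {for 0, continuous y}.
  have [|+ _] := dy 0; first by rewrite normr0.
  by move=> /derivable1_diffP/differentiable_continuous.
have yN (P : E -> Prop) : (\forall z \near p, P z) -> \forall t \near (0 : R), P (y t).
  by rewrite -y0 => /cty.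
have N1 := yN _ (cimg_near cp).
have N2 := yN _ LP.
have [r r0 rP] : exists2 r : R, 0 < r & forall t, `|t| < r -> cimg c (y t) /\
    forall w, `|'D_w (leftX c b) (y t)| <= L * `|w|.
  have : \forall t \near (0 : R), cimg c (y t) /\
      forall w, `|'D_w (leftX c b) (y t)| <= L * `|w|.
    by apply: filterS2 N1 N2 => t A B; split; [exact: A|exact: B].
  move=> /nbhs_ballP[r /= r0 rP]; exists r; first exact: r0.
  move=> t tr; have bt : ball (0 : R) r t by rewrite -ball_normE /= sub0r normrN.
  exact: (rP t bt).
pose e1 := Num.min e0 r.
have e1_gt0 : 0 < e1 by rewrite lt_min e0_gt0.
have e1P (t : R) : `|t| < e1 -> `|t| < e0 /\ `|t| < r.
  by rewrite lt_min => /andP.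
pose d t := leftX c a (y t) - rightX c a (y t).
pose d' t := 'D_(d t) (leftX c b) (y t).
have dd (t : R) : `|t| < e1 -> is_derive t 1 d (d' t).
  move=> /e1P[te tr]; have [cy _] := rP _ tr.
  have D1 := smooth_at_differentiable hE hE (leftX_smooth ac c1 a cy).
  have D2 := smooth_at_differentiable hE hE (rightX_smooth ac c1 a cy).
  have D3 := smooth_at_differentiable hE hE (leftX_smooth ac c1 b cy).
  have E1 := is_derive_comp (dy t te) D1; have E2 := is_derive_comp (dy t te) D2.
  have E3 := is_deriveB E1 E2.
  (* The chain rule differentiates two different fields along X_b. The commutation relations turn
     both into derivatives of the one field X_b, along X_a and along Z_a, and linearity in the
     direction leaves its derivative along their difference. *)
  have E4 := leftX_commute ac c1 cy H; have E5 := leftX_rightX_commute ac c1 a b cy.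
  have E6 := derive_linear_dir (leftX c a (y t)) (rightX c a (y t)) D3.
  have E7 := etrans (congr2 (fun v w : E => v - w) (esym E4) (esym E5)) (esym E6).
  exact: is_derive_eq E3 E7.
have dL (t : R) : `|t| < e1 -> `|d' t| <= L * `|d t|.
  by move=> /e1P[_ tr]; have [_ B] := rP _ tr; exact: (B (d t)).
have X0 := etrans (congr1 (leftX c a) y0) (leftXp c1 a).
have Z0 := etrans (congr1 (rightX c a) y0) (rightXp c1 a).
have d0 := etrans (congr2 (fun v w : E => v - w) X0 Z0) (subrr a).
have [r' r'0 r'P] := linear_growth_zero e1_gt0 L0 dd dL d0.
pose eps := Num.min e1 r'.
have epsP (t : R) : `|t| < eps -> `|t| < e1 /\ `|t| < r' by rewrite lt_min => /andP.
have epsC (t : R) : `|t| < eps -> cimg c (y t).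
  by move=> /epsP[/e1P[_ /rP[]]].
have eps0 : 0 < eps by rewrite lt_min e1_gt0.
have sy : smooth_on [set t : R^o | `|t| < eps] y.
  apply: (@integral_curve_smooth R n (leftX c b)); first exact: open_norm_lt.
    by move=> t /= te; exact: (leftX_smooth ac c1 b (epsC _ te)).
  by move=> t /= te; have [/e1P[te0 _] _] := epsP _ te; exact: (dy t te0).
have g0 : (cinv c \o y) 0 = 1%g by rewrite /= y0 (cmap_cinv c1).
have cg : {for (0 : R^o), continuous (cinv c \o y)}.
  apply: continuous_comp; first exact: cty.
  by apply: cinv_continuous_at; rewrite y0; exact: cp.
have dg : is_derive (0 : R^o) (1 : R^o) (cmap c \o (cinv c \o y)) b.
  have d0y : is_derive (0 : R) 1 y b.
    have e00 : `|0 : R| < e0 by rewrite normr0.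
    have B := etrans (congr1 (leftX c b) y0) (leftXp c1 b).
    exact: is_derive_eq (dy 0 e00) B.
  apply: near_eq_is_derive d0y.
  by apply: filterS N1 => t ct; rewrite /= (cinvK ct).
exists eps, (cinv c \o y); split.
- exact: eps0.
- exact: chart_curve_smooth.
- exact: g0.
- move=> t te; apply/(Ad_chart_vector ac c1 a (epsC _ te)).
  have [_ tr'] := epsP _ te; have /eqP := r'P _ tr'.
  by rewrite subr_eq0 => /eqP.
- exact: esym (velocityE ac c1 cg g0 dg).
Qed.

End CentralizerFlow.

(** * The stabilizer of a vector under the adjoint action *)

Section AdjointStabilizer.
Variables (R : realType) (n : nat) (G : lieGroupType R n).
Implicit Types (xi : tangent_vector G) (g h : G).

Lemma Ad1 xi : Ad 1%g xi = xi.
Proof.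
apply/funext => f; rewrite /Ad; congr xi; apply/funext => x.
by rewrite mul1g invg1 mulg1.
Qed.

Lemma AdM g h xi : Ad (g * h)%g xi = Ad g (Ad h xi).
Proof.
apply/funext => f; rewrite /Ad; congr xi; apply/funext => x.
by rewrite invgM !mulgA.
Qed.

Lemma CM_group_closed xi : group_closed (mem (CM xi)).
Proof.
split=> [|g h]; first by apply/mem_set; exact: Ad1.
move=> /set_mem gxi /set_mem hxi; apply/mem_set; rewrite /CM /= AdM.
have -> : Ad h^-1%g xi = xi by rewrite -[in LHS]hxi -AdM mulVg Ad1.
exact: gxi.
Qed.

End AdjointStabilizer.

Theorem proposition3 (R : realType) (n : nat) (G : lieGroupType R n) :
  (forall xi : tangent_vector G, lie_algebra [set: G] xi ->
     group_closed (mem (CM xi))) /\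
  (forall xi : tangent_vector G, lie_algebra [set: G] xi ->
     lie_algebra (CM xi) =
     [set eta | lie_algebra [set: G] eta /\ ad xi eta = (fun=> 0%R)]).
Proof.
have [c ac c1] := atlas_cover (1%g : G).
split=> xi xi_lie; first exact: CM_group_closed.
have [a xiE] := lie_algebra_chart_vector ac c1 xi_lie.
apply/seteqP; split=> [_ [eps [gamma [eps0 sg g0 CMg ->]]]|eta [eta_lie br]].
  split; first by exists eps, gamma.
  have e0 : `|0 : R| < eps by rewrite normr0.
  have cg : {for (0 : R^o), continuous gamma} by apply: sg.1; rewrite inE.
  have c0 : cdom c (gamma 0) by rewrite g0.
  have dg := derivableP (smooth_at_derivable (v := 1 : R^o) (smooth_curve_smooth ac sg e0 c0)).
  rewrite (velocityE ac c1 cg g0 dg) xiE; rewrite xiE in CMg.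
  exact: (bracket_centralizer ac c1 eps0 cg g0 dg CMg).
have [b etaE] := lie_algebra_chart_vector ac c1 eta_lie.
rewrite xiE etaE in br *.
exact: centralizer_flow.
Qed.
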